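(* Let $k\ge2$ and let $\Gamma$ be a finite generating set of $M_{k,1}$. The $\mathcal R$-order decision problem of $M_{k,1}$ (given $\psi,\varphi\in M_{k,1}$, decide whether $\psi\le_{\mathcal R}\varphi$) is decidable in deterministic polynomial time, if the inputs $\psi,\varphi$ are given by tables or by words over $\Gamma$.
   Context: $A$ is an alphabet with $k\ge2$ letters, $A^*$ the free monoid over $A$. A right ideal of $A^*$ is a set $R\subseteq A^*$ with $RA^*\subseteq R$; it is generated by a unique prefix code (a set of words none of which is a prefix of another). A right ideal homomorphism is a function $\varphi$ whose domain ${\sf Dom}(\varphi)\subseteq A^*$ is a right ideal, with values in $A^*$ and $\varphi(xw)=\varphi(x)w$ for all $x\in{\sf Dom}(\varphi)$, $w\in A^*$; ${\sf domC}(\varphi)$ is the prefix code generating ${\sf Dom}(\varphi)$. ${\sf riHom}(A^* )$ is the set of right ideal homomorphisms with finitely generated domain. A right ideal $R'\subseteq R$ is essential in the right ideal $R$ iff $R'$ intersects every nonempty right ideal contained in $R$. $\Phi$ is an essentially equal restriction of $\varphi$ (and $\varphi$ an essentially equal extension of $\Phi$) iff $\Phi$ is a restriction of $\varphi$ and ${\sf Dom}(\Phi)$ is essential in ${\sf Dom}(\varphi)$. Every $\varphi\in{\sf riHom}(A^* )$ has a unique maximal essentially equal extension $\max(\varphi)$. The Thompson-Higman monoid is $M_{k,1}=\{\max(\varphi):\varphi\in{\sf riHom}(A^* )\}$ with multiplication $\psi\varphi=\max(\psi\circ\varphi)$ (functions act on the left); $\varphi$ represents the element $\max(\varphi)$.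 $M_{k,1}$ is finitely generated. $\psi\le_{\mathcal R}\varphi$ means $\psi=\varphi\alpha$ for some $\alpha\in M_{k,1}$. A table of an element of $M_{k,1}$ is the finite list of pairs $(x,\varphi(x))$, $x\in{\sf domC}(\varphi)$, for some $\varphi\in{\sf riHom}(A^* )$ representing it; its size is the sum of the lengths of all words occurring in it. A word over $\Gamma$ represents the product of its letters in $M_{k,1}$; its size is its length. *)

(* Defs.v *)
From HB Require Import structures.
From mathcomp Require Import all_boot.
From mathcomp Require Import zify.
From mathcomp Require Import boolp classical_sets cardinality.

Set Implicit Arguments.
Unset Strict Implicit.
Unset Printing Implicit Defensive.

Local Open Scope classical_set_scope.

(** * The Thompson-Higman monoid *)

Section ThompsonHigman.
Variable A : finType.
Implicit Types (R C : set (seq A)).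

(* A partial function on A^*; [None] means "undefined". *)
Definition wpfun : Type := seq A -> option (seq A).
Implicit Types (phi psi : wpfun).

Definition Dom phi : set (seq A) := [set x | exists y, phi x = Some y].

Definition right_ideal R := forall x w, R x -> R (x ++ w).

(* The right ideal C A^* generated by C. *)
Definition right_ideal_gen C : set (seq A) :=
  [set c ++ w | c in C & w in [set: seq A]].

Definition prefix_code C := forall u v, C u -> C v -> prefix u v -> u = v.

Definition right_ideal_hom phi :=
  right_ideal (Dom phi) /\
  forall x y w, phi x = Some y -> phi (x ++ w) = Some (y ++ w).

(* C = domC(phi); this C is unique. *)
Definition is_domC phi C := prefix_code C /\ Dom phi = right_ideal_gen C.

Definition riHom phi :=
  right_ideal_hom phi /\
  exists2 C, finite_set C & Dom phi = right_ideal_gen C.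

Definition essential R' R :=
  R' `<=` R /\
  forall I, right_ideal I -> I !=set0 -> I `<=` R -> R' `&` I !=set0.

Definition restriction phi psi := forall x y, phi x = Some y -> psi x = Some y.

(* psi is an essentially equal extension of phi. *)
Definition ess_extension psi phi :=
  restriction phi psi /\ essential (Dom phi) (Dom psi).

Definition is_max_ess_extension phi psi :=
  [/\ riHom psi, ess_extension psi phi &
      forall chi, riHom chi -> ess_extension chi phi -> restriction psi chi ->
        chi = psi].

(* max(phi): for phi in riHom(A^* ) the maximal essentially equal extension
   exists and is unique, so the default value is never used. *)
Definition max_ext phi : wpfun := xget phi (is_max_ess_extension phi).

Definition thompson_higman : set wpfun := [set max_ext phi | phi in riHom].

Definition th_mul psi phi : wpfun := max_ext (pcomp psi phi).

Definition th_one : wpfun := max_ext (@Some (seq A)).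

(* psi <=_R phi *)
Definition leR psi phi :=
  exists2 alpha, thompson_higman alpha & psi = th_mul phi alpha.

End ThompsonHigman.

Arguments th_one A : clear implicits.

Section Descriptions.
Variables (A G : finType) (gamma : G -> wpfun A).

(* The letter g of the alphabet G stands for the element [gamma g]. *)
Definition word_value (w : seq G) : wpfun A :=
  foldr (fun g m => th_mul (gamma g) m) (th_one A) w.

Definition generating_set :=
  [/\ injective gamma,
      forall g, thompson_higman (gamma g) &
      forall m, thompson_higman m -> exists w, word_value w = m].

Definition is_table (t : seq (seq A * seq A)) (phi : wpfun A) :=
  [/\ uniq (unzip1 t), is_domC phi [set` unzip1 t] &
      forall x y, (x, y) \in t -> phi x = Some y].

Variant description :=
  | ByTable of seq (seq A * seq A)
  | ByWord of seq G.

Definition describes (d : description) (m : wpfun A) : Prop :=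
  match d with
  | ByTable t => exists phi, [/\ riHom phi, is_table t phi & m = max_ext phi]
  | ByWord w => m = word_value w
  end.

Definition description_size (d : description) : nat :=
  match d with
  | ByTable t => \sum_(xy <- t) (size xy.1 + size xy.2)
  | ByWord w => size w
  end.

End Descriptions.

(** * Encoding of instances as strings *)

Variant mark := TableTag | WordTag | Comma | Semicolon.

Definition mark_code (m : mark) : bool * bool :=
  match m with
  | TableTag => (false, false) | WordTag => (false, true)
  | Comma => (true, false) | Semicolon => (true, true)
  end.
Definition mark_decode (b : bool * bool) : mark :=
  match b with
  | (false, false) => TableTag | (false, true) => WordTag
  | (true, false) => Comma | (true, true) => Semicolon
  end.
Lemma mark_codeK : cancel mark_code mark_decode. Proof. by case. Qed.
HB.instance Definition _ := Finite.copy mark (can_type mark_codeK).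

Section Encoding.
Variables A G : finType.

Definition symbol : finType := ((A + G) + mark)%type.

Definition enc_mark (m : mark) : symbol := inr m.
Definition enc_letter (a : A) : symbol := inl (inl a).
Definition enc_generator (g : G) : symbol := inl (inr g).

Definition enc_pair (xy : seq A * seq A) : seq symbol :=
  map enc_letter xy.1 ++ enc_mark Comma
    :: rcons (map enc_letter xy.2) (enc_mark Semicolon).

(* The leading tags make the concatenation of two codes uniquely decodable. *)
Definition encode (d : description A G) : seq symbol :=
  match d with
  | ByTable t => enc_mark TableTag :: flatten (map enc_pair t)
  | ByWord w => enc_mark WordTag :: map enc_generator w
  end.

Lemma size_encode_table (t : seq (seq A * seq A)) :
  size (encode (ByTable G t)) =
    (description_size (ByTable G t) + (size t).*2).+1.
Proof.
rewrite /=; congr _.+1; elim: t => [|xy t IH] /=; first by rewrite big_nil.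
rewrite big_cons size_cat IH /enc_pair size_cat /= size_rcons !size_map.
lia.
Qed.

(* Hence bounds polynomial in the length of the code and bounds polynomial in
   the size of the described data are the same. *)
Lemma size_encode (gamma : G -> wpfun A) (d : description A G) (m : wpfun A) :
  describes gamma d m ->
  description_size d <= size (encode d) <= 3 * description_size d + 3.
Proof.
case: d => [t|w]; last first.
  by rewrite /= size_map; lia.
rewrite size_encode_table => -[phi [_ [t_uniq [t_code _] _] _]].
suff: size t <= (description_size (ByTable G t)).+1 by lia.
have [|t_gt1] := leqP (size t) 1; first by move/leq_trans; apply.
apply: leqW; rewrite -sum1_size big_seq [leqRHS]big_seq.
apply: leq_sum => -[x y] xy_t /=; case: x xy_t => [|//] e_t.
suff: size (unzip1 t) <= 1 by rewrite size_map leqNgt t_gt1.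
have e_in : [::] \in unzip1 t by apply/mapP; exists ([::], y).
apply: (@uniq_leq_size _ _ [:: [::]]) => // v v_in.
by rewrite inE -(t_code [::] v e_in v_in (prefix0s v)).
Qed.

End Encoding.

(** * Deterministic polynomial time *)

Variant direction := Left | Stay | Right.

(* A deterministic multi-tape Turing machine with input alphabet S.  The tape
   alphabet is [option (S + work)], where [None] is the blank; there are
   [aux.+1] tapes, infinite in both directions; a state q with
   [verdict q = Some b] is halting, with answer b. *)
Record machine (S : finType) := Machine {
  state : finType;
  work : finType;
  aux : nat;
  start : state;
  verdict : state -> option bool;
  trans : state -> {ffun 'I_aux.+1 -> option (S + work)} ->
          state * ('I_aux.+1 -> option (S + work) * direction)
}.

(* [lhs] lists the cells to the left of the head, nearest first; beyond the
   ends of both lists the tape is blank. *)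
Record tape (X : Type) := Tape {
  lhs : seq (option X); cell : option X; rhs : seq (option X)
}.

Definition tape_of (X : Type) (w : seq X) : tape X :=
  if w is x :: w' then Tape [::] (Some x) (map Some w')
  else Tape [::] None [::].

Definition write_move (X : Type) (act : option X * direction) (t : tape X) :
    tape X :=
  let: (c, d) := act in
  match d with
  | Stay => Tape (lhs t) c (rhs t)
  | Left => Tape (behead (lhs t)) (head None (lhs t)) (c :: rhs t)
  | Right => Tape (c :: lhs t) (head None (rhs t)) (behead (rhs t))
  end.

Section Run.
Variables (S : finType) (M : machine S).

Definition config : Type :=
  state M * ('I_(aux M).+1 -> tape (S + work M)%type).

Definition init (w : seq S) : config :=
  (start M, fun i => tape_of (if i == ord0 then map inl w else [::])).

Definition step (c : config) : config :=
  if verdict c.1 is Some _ then c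
  else let: (q, act) := trans c.1 [ffun i => cell (c.2 i)] in
       (q, fun i => write_move (act i) (c.2 i)).

Definition halts_with (w : seq S) (n : nat) (b : bool) :=
  verdict (iter n step (init w)).1 = Some b.

Definition decides_in_time (L : set (seq S)) (T : nat -> nat) :=
  forall w, exists2 b, halts_with w (T (size w)) b & (b <-> L w).

End Run.

Definition poly_time_decidable (S : finType) (L : set (seq S)) :=
  exists (M : machine S) (c d : nat),
    decides_in_time M L (fun n => c * n ^ d + c).

(** * The R-order decision problem *)

(* The strings that code pairs (psi, phi) with psi <=_R phi, where each of psi
   and phi is given either by a table or by a word over the generators. *)
Definition R_order_problem (A G : finType) (gamma : G -> wpfun A) :
    set (seq (symbol A G)) :=
  [set s | exists d e psi phi,
     [/\ describes gamma d psi, describes gamma e phi,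
         s = encode d ++ encode e & leR psi phi]].

(* Main.v *)
Require Import Defs.
From mathcomp Require Import all_boot.
From mathcomp Require Import zify.
From mathcomp Require Import boolp classical_sets cardinality.

(* For representatives psi and phi one has psi <=_R phi iff every word of
   Im(psi) has an extension in Im(phi).  If this holds, the restriction of psi
   to the words that it maps into Im(phi) represents the same element and
   factors through phi; conversely, psi and phi o alpha agree on an essential
   right ideal.  The condition depends only on finite sets F1, F2 generating the
   two images, and it is enough to compare with the elements of F2 each word y of
   F1 and each word pa, where a is a letter and the proper prefix p of an element
   of F2 extends y.

   For a table, the values generate the image.  Along a word over the generators
   one carries generators of the image from right to left: if C is a finite set
   generating the domain of g and F generates I, then the image of I under g is
   generated by the single values g(f) for those f in F that have a prefix in C,
   and by the values g(c) for those c in C that have a prefix in F.  So a letter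
   adds at most |C| generators and lengthens each by a constant, and the sets
   remain of polynomial size, although the table of the product need not. *)

Set Implicit Arguments.
Unset Strict Implicit.
Unset Printing Implicit Defensive.

(** * Polynomials and stack programs *)

(** Multiplication in the monoid passes to [max_ext], which may enlarge images. Density is blind to
    this: the images of a homomorphism and of an essentially equal extension are dense in each
    other. Products can therefore be replaced by plain compositions, and no maximal extension is
    ever computed. The time bound concerns multi-tape machines. Programs are written in a language
    of stacks whose cost is the step count of the compiled machine, and are then combined through
    [computable], which is closed under composition, case distinction and folds. The obstacle is
    iteration: repeating a polynomial-time map can produce data of exponential size. Every fold
    therefore demands a polynomial bound on its accumulator after each part of the list already
    read, and for words over the generators this rests on the growth per letter being additive.
    Strings that code no instance have to be rejected too, so the program also checks the syntax and
    that the arguments of a table form a prefix code without repetitions. *)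

Inductive polynomial : (nat -> nat) -> Prop :=
| poly_const c : polynomial (fun=> c)
| poly_id : polynomial (fun n => n)
| poly_add P Q : polynomial P -> polynomial Q -> polynomial (fun n => P n + Q n)
| poly_mul P Q : polynomial P -> polynomial Q -> polynomial (fun n => P n * Q n).

(** Coefficients are natural numbers and there is no subtraction. Monotonicity lets time bounds be
    applied to mere upper bounds of sizes. *)
Lemma polynomial_mono P : polynomial P -> {homo P : m n / m <= n}.
Proof.
elim=> [c|//|{}P Q _ hP _ hQ|{}P Q _ hP _ hQ] m n le_mn //.
- by rewrite leq_add ?hP ?hQ.
- by rewrite leq_mul ?hP ?hQ.
Qed.

Lemma polynomial_comp P Q :
  polynomial P -> polynomial Q -> polynomial (fun n => P (Q n)).
Proof. by elim=> *; do ?constructor; auto. Qed.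

Lemma polynomial_sum (I : Type) (r : seq I) (P : I -> nat -> nat) :
  (forall i, polynomial (P i)) -> polynomial (fun n => \sum_(i <- r) P i n).
Proof.
move=> hP; elim: r => [|i r IH].
  by have -> : (fun n => \sum_(i <- [::]) P i n) = fun=> 0;
    [apply/funext => n; rewrite big_nil | constructor].
have -> : (fun n => \sum_(j <- i :: r) P j n) =
          fun n => P i n + \sum_(j <- r) P j n.
  by apply/funext => n; rewrite big_cons.
by constructor.
Qed.

Lemma polynomial_le_monomial P : polynomial P ->
  exists c d, forall n, P n <= c * n ^ d + c.
Proof.
move=> polyP.
(* Powers of [n.+1] are positive, so monomials of different degrees absorb each other. The return to
   [n ^ d] costs a factor [2 ^ d], and the additive constant covers [n = 0]. *)
suff [c [d le_P]] : exists c d, forall n, P n <= c * n.+1 ^ d.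
  exists (c * 2 ^ d), d => n; apply: leq_trans (le_P n) _.
  rewrite -mulnA -mulnDr leq_mul2l; apply/orP; right; case: n => [|n].
    by rewrite exp1n (leq_trans _ (leq_addl _ _)) ?expn_gt0.
  rewrite -expnMn; apply: leq_trans (leq_addr _ _).
  by case: d {le_P} => // d; rewrite leq_exp2r //; lia.
elim: polyP => [c||{}P Q _ [c [d hP]] _ [c' [d' hQ]]|{}P Q _ [c [d hP]] _ [c' [d' hQ]]].
- by exists c, 0 => n; rewrite expn0 muln1.
- by exists 1, 1 => n; rewrite expn1 mul1n.
- exists (c + c'), (maxn d d') => n; rewrite mulnDl.
  apply: leq_add; [apply: leq_trans (hP n) _|apply: leq_trans (hQ n) _].
    by rewrite leq_mul2l leq_pexp2l ?orbT ?leq_maxl.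
  by rewrite leq_mul2l leq_pexp2l ?orbT ?leq_maxr.
- exists (c * c'), (d + d') => n.
  by rewrite expnD mulnACA leq_mul.
Qed.

Section Commands.
Variable X : finType.

(* Registers are stacks; [While r f] pops a symbol [x] off [r] and runs [f x],
   until [r] is empty. *)
Inductive cmd :=
| Skip
| Push of nat & X
| Pop of nat
| Seq of cmd & cmd
| Case of nat & (option X -> cmd)
| While of nat & (X -> cmd).

Definition store := nat -> seq X.

Definition upd (s : store) r v : store := fun i => if i == r then v else s i.

(** A relation, since a loop need not end. The costs are the exact step counts of the compiled
    fragments: [Push] takes two steps because the head moves left before it writes, and [Seq] adds
    none. *)
Inductive exec : cmd -> store -> nat -> store -> Prop :=
| exec_skip s : exec Skip s 1 s
| exec_push r x s : exec (Push r x) s 2 (upd s r (x :: s r))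
| exec_pop r s : exec (Pop r) s 1 (upd s r (behead (s r)))
| exec_seq p q s n s1 m s2 :
    exec p s n s1 -> exec q s1 m s2 -> exec (Seq p q) s (n + m) s2
| exec_case r f s n s1 :
    exec (f (ohead (s r))) s n s1 -> exec (Case r f) s n.+1 s1
| exec_while_nil r f s : s r = [::] -> exec (While r f) s 1 s
| exec_while_cons r f s x l n s1 m s2 :
    s r = x :: l -> exec (f x) (upd s r l) n s1 -> exec (While r f) s1 m s2 ->
    exec (While r f) s (n + m).+1 s2.

(** No unit of cost adds more than one symbol, so a time bound for a program also bounds the size of
    its result. *)
Lemma exec_size p s n s' r : exec p s n s' -> size (s' r) <= size (s r) + n.
Proof.
elim=> {p s n s'} [s|r' x s|r' s|p q s n s1 m s2 _ h1 _ h2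
  |r' f s n s1 _ h|r' f s _|r' f s x l n s1 m s2 e_l _ h1 _ h2].
- exact: leq_addr.
- by rewrite /upd; case: eqVneq => [->|_] /=; lia.
- by rewrite /upd; case: eqVneq => [->|_]; rewrite ?size_behead; lia.
- lia.
- lia.
- exact: leq_addr.
- have : size (upd s r' l r) <= size (s r).
    by rewrite /upd; case: eqVneq => // ->; rewrite e_l /=.
  lia.
Qed.

Fixpoint max_register p :=
  match p with
  | Skip => 0
  | Push r _ | Pop r => r
  | Seq p q => maxn (max_register p) (max_register q)
  | Case r f => maxn r (\max_(x : option X) max_register (f x))
  | While r f => maxn r (\max_(x : X) max_register (f x))
  end.

(** * Compilation into machine fragments with one tape per register *)

Section Compilation.
Variable N : nat.
Local Notation tapes := ('I_N.+1 -> tape X).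
Local Notation scan := {ffun 'I_N.+1 -> option X}.
Local Notation action := ('I_N.+1 -> option X * direction).

(* A fragment leaves control by moving to the state [None]. *)
Record fragment := Fragment {
  fstate : finType;
  fstart : fstate;
  ftrans : fstate -> scan -> option fstate * action
}.

Definition scan_of (t : tapes) : scan := [ffun i => cell (t i)].
Definition act_on (a : action) (t : tapes) : tapes :=
  fun i => write_move (a i) (t i).
Definition idle (v : scan) : action := fun i => (v i, Stay).
Definition act_at r (c : option X) d (v : scan) : action :=
  fun i => if i == inord r then (c, d) else (v i, Stay).

Inductive runs (F : fragment) : option (fstate F) -> tapes -> nat -> tapes -> Prop :=
| runs_exit t : runs None t 0 t
| runs_step q t q' a n t' : ftrans q (scan_of t) = (q', a) ->
    runs q' (act_on a t) n t' -> runs (Some q) t n.+1 t'.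

(** Joins a fragment to its continuation: leaving the inner fragment is already entering [exit], so
    the step counts add up exactly. *)
Lemma runs_embed (F H : fragment) (emb : fstate F -> fstate H)
    (exit : option (fstate H)) q t n t' m t'' :
  (forall q v, ftrans (emb q) v =
     (if (ftrans q v).1 is Some q' then Some (emb q') else exit,
      (ftrans q v).2)) ->
  runs (F := F) q t n t' -> runs exit t' m t'' ->
  runs (if q is Some q' then Some (emb q') else exit) t (n + m) t''.
Proof.
move=> h; elim=> {q t n t'} [//|q t q' a n t' e _ IH] hm.
by rewrite addSn; apply: runs_step (IH hm); rewrite h e.
Qed.

(** In [Case] and [While] the state [None] of the option type reads the top of the stack, and a
    [Tagged] state belongs to the branch of the symbol read. The exit of a loop body leads back to
    the test. *)
Fixpoint compile p : fragment :=
  match p with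
  | Skip => @Fragment unit tt (fun _ v => (None, idle v))
  | Push r x => @Fragment bool false (fun b v =>
      if b then (None, act_at r (Some x) Stay v)
      else (Some true, act_at r (v (inord r)) Left v))
  | Pop r => @Fragment unit tt (fun _ v => (None, act_at r None Right v))
  | Seq p q =>
      let F := compile p in let H := compile q in
      @Fragment (fstate F + fstate H)%type (inl (fstart F)) (fun q v =>
        match q with
        | inl q => let: (q', a) := ftrans q v in
            (Some (if q' is Some q' then inl q' else inr (fstart H)), a)
        | inr q => let: (q', a) := ftrans q v in (omap inr q', a)
        end)
  | Case r f =>
      let F x := compile (f x) in
      @Fragment (option {x : option X & fstate (F x)}) None (fun q v =>
        match q with
        | None => (Some (Some (Tagged (fun x => fstate (F x)) (fstart (F (v (inord r)))))), idle v)
        | Some q => let: (q', a) := ftrans (tagged q) v in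
            (omap (fun q' => Some (Tagged (fun x => fstate (F x)) q')) q', a)
        end)
  | While r f =>
      let F x := compile (f x) in
      @Fragment (option {x : X & fstate (F x)}) None (fun q v =>
        match q with
        | None =>
            if v (inord r) is Some x
            then (Some (Some (Tagged (fun x => fstate (F x)) (fstart (F x)))), act_at r None Right v)
            else (None, idle v)
        | Some q => let: (q', a) := ftrans (tagged q) v in
            (Some (omap (Tagged (fun x => fstate (F x))) q'), a)
        end)
  end.

(** The top of the stack lies under the head. Popping leaves a blank on the left, and exhausted
    cells on the right may be listed as blanks; hence the unspecified [i] and [j]. *)
Definition holds_stack (t : tape X) (l : seq X) := exists i j,
  t = Tape (nseq i None) (ohead l) (map Some (behead l) ++ nseq j None).

Definition holds_store (t : tapes) (s : store) :=
  forall i : 'I_N.+1, holds_stack (t i) (s i).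

Lemma holds_pop t l :
  holds_stack t l -> holds_stack (write_move (None, Right) t) (behead l).
Proof.
case=> i [j ->]; exists i.+1.
by case: l => [|x [|y l]] /=; [exists j.-1; case: j ..|exists j].
Qed.

Lemma holds_push t l x : holds_stack t l ->
  holds_stack (write_move (Some x, Stay) (write_move (ohead l, Left) t)) (x :: l).
Proof.
case=> i [j ->]; exists i.-1; case: l => [|y l] /=.
  by exists j.+1; case: i.
by exists j; case: i.
Qed.

Lemma scan_holds t s r :
  holds_store t s -> r <= N -> scan_of t (inord r) = ohead (s r).
Proof.
move=> ts le_r; rewrite ffunE; have [i [j ->]] := ts (inord r).
by rewrite /= inordK.
Qed.

Lemma act_on_idle t s :
  holds_store t s -> holds_store (act_on (idle (scan_of t)) t) s.
Proof.
move=> ts i; rewrite /act_on /idle ffunE.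
by case: (t i) (ts i).
Qed.

Lemma act_on_at t r c d : r <= N -> act_on (act_at r c d (scan_of t)) t =
  fun i : 'I_N.+1 => if i == r :> nat then write_move (c, d) (t i) else t i.
Proof.
move=> le_r; apply/funext => i; rewrite /act_on /act_at ffunE -val_eqE /= inordK //.
by case: eqP => // _; case: (t i).
Qed.

Lemma act_on_pop t s r : holds_store t s -> r <= N ->
  holds_store (act_on (act_at r None Right (scan_of t)) t)
              (upd s r (behead (s r))).
Proof.
move=> ts le_r i; rewrite act_on_at // /upd.
by case: eqVneq (ts i) => [-> /holds_pop|].
Qed.

Lemma exec_runs p s n s' t :
  exec p s n s' -> max_register p <= N -> holds_store t s ->
  exists2 t', runs (F := compile p) (Some (fstart (compile p))) t n t' &
              holds_store t' s'.
Proof.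
move=> ex; elim: ex t => {p s n s'} [s|r x s|r s|p q s n s1 m s2 _ h1 _ h2
  |r f s n s1 _ h|r f s e_l|r f s x l n s1 m s2 e_l _ h1 _ h2] t /=.
- move=> _ ts; exists (act_on (idle (scan_of t)) t); last exact: act_on_idle.
  by apply: (@runs_step (compile Skip)); last exact: runs_exit.
- move=> le_r ts.
  set t1 := act_on (act_at r (scan_of t (inord r)) Left (scan_of t)) t.
  exists (act_on (act_at r (Some x) Stay (scan_of t1)) t1).
    apply: (@runs_step (compile (Push r x))) => //=.
    by apply: (@runs_step (compile (Push r x))) => //=; exact: runs_exit.
  move=> i; rewrite act_on_at // /t1 act_on_at // /upd (scan_holds ts le_r).
  by case: eqVneq (ts i) => [-> /(holds_push x)|].
- move=> le_r ts; exists (act_on (act_at r None Right (scan_of t)) t).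
    by apply: (@runs_step (compile (Pop r))) => //=; exact: runs_exit.
  exact: act_on_pop.
- rewrite geq_max => /andP[le_p le_q] ts.
  have [t1 r1 /(h2 _ le_q)[t2 r2 t2s]] := h1 _ le_p ts; exists t2 => //.
  have r2' : runs (F := compile (Seq p q)) (Some (inr (fstart (compile q)))) t1 m t2.
    rewrite -[m]addn0.
    apply: (@runs_embed _ (compile (Seq p q)) inr None) r2 (runs_exit _ _).
    by move=> q1 v /=; case: ftrans => -[].
  apply: (@runs_embed _ (compile (Seq p q)) inl _) r1 r2'.
  by move=> q1 v /=; case: ftrans => -[].
- rewrite geq_max => /andP[le_r /bigmax_leqP le_f] ts.
  have [t1 r1 t1s] := h _ (le_f (ohead (s r)) isT) (act_on_idle ts).
  exists t1 => //; apply: runs_step => //=; rewrite (scan_holds ts le_r) -[n]addn0.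
  apply: (@runs_embed _ (compile (Case r f)) (fun q => Some (Tagged (fun x => fstate (compile (f x))) q)) None)
    r1 (runs_exit _ _).
  by move=> q1 v /=; case: ftrans => -[].
- rewrite geq_max => /andP[le_r _] ts.
  exists (act_on (idle (scan_of t)) t); last exact: act_on_idle.
  apply: (@runs_step (compile (While r f))); last exact: runs_exit.
  by rewrite /= (scan_holds ts le_r) e_l.
- move=> le_rf ts; have := le_rf; rewrite geq_max => /andP[le_r /bigmax_leqP le_f].
  have ts1 : holds_store (act_on (act_at r None Right (scan_of t)) t) (upd s r l).
    by have := act_on_pop ts le_r; rewrite e_l.
  have [t1 r1 t1s] := h1 _ (le_f x isT) ts1.
  have [t2 r2 t2s] := h2 _ le_rf t1s; exists t2 => //.
  apply: runs_step => /=; first by rewrite (scan_holds ts le_r) e_l.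
  apply: (@runs_embed _ (compile (While r f)) (fun q => Some (Tagged (fun x => fstate (compile (f x))) q)) _)
    r1 r2.
  by move=> q1 v /=; case: ftrans => -[].
Qed.
End Compilation.
End Commands.
Arguments Skip {X}.
Arguments Pop {X}.

(** * From fragments to deciding machines *)

Section Deciders.
Variables (S W : finType).
Local Notation X := (S + W)%type.

(* After running [p], one more step reads the verdict off register [out]. *)
Definition decider (p : cmd X) (N out : nat) : machine S :=
  let F := compile N p in
  @Machine S (fstate F + option bool)%type W N (inl (fstart F))
    (fun q => if q is inr b then b else None)
    (fun q v => match q with
       | inl q => let: (q', a) := ftrans q v in
           (if q' is Some q' then inl q' else inr None, a)
       | inr _ => (inr (Some (v (inord out) : bool)), idle v)
       end).

Lemma decider_runs p N out q t n t' : runs (F := compile N p) q t n t' ->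
  iter n (step (M := decider p N out))
         ((if q is Some q' then inl q' else inr None), t) = (inr None, t').
Proof.
elim=> {q t n t'} [//|q t q' a n t' e _ IH].
by rewrite iterSr -IH /step /=; move: e; rewrite /scan_of => ->.
Qed.

Definition initial_store (w : seq S) : store X :=
  fun r => if r == 0 then map inl w else [::].

Lemma decider_correct p N out w n s' :
  exec p (initial_store w) n s' -> max_register p <= N -> out <= N ->
  forall T, n < T -> halts_with (decider p N out) w T (s' out != [::]).
Proof.
move=> ex le_p le_out T lt_nT.
have ini : holds_store (init (decider p N out) w).2 (initial_store w).
  move=> i; exists 0, 0; rewrite /= /tape_of /initial_store -val_eqE /=.
  by case: (i == 0 :> nat) => //; case: w {ex} => //= x w; rewrite cats0.
have [t' rn ts'] := exec_runs ex le_p ini.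
have {}rn := decider_runs out rn.
rewrite /halts_with -(subnK lt_nT) iterD iterS.
have -> : iter n (step (M := decider p N out)) (init _ w) = (inr None, t') := rn.
set c := step _; have {c}-> : c = (inr (Some (s' out != [::])),
    act_on (idle (scan_of t')) t') :> config (decider p N out).
  by rewrite /c /step /= (scan_holds ts' le_out); case: (s' out).
(* [step] fixes a halting configuration, so the verdict persists up to time [T]. *)
elim: (T - n.+1) => [//|m IH]; rewrite iterS {1}/step IH; exact: IH.
Qed.
End Deciders.

(** * Programs with polynomial running time *)

Section BoundedExecution.
Variable X : finType.
Implicit Types (s : store X) (p q : cmd X).

Definition exec_within p s B s' := exists2 n, n <= B & exec p s n s'.

Lemma exec_within_le B p s B' s' :
  exec_within p s B s' -> B <= B' -> exec_within p s B' s'.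
Proof. by case=> n le_n ex le_B; exists n => //; apply: leq_trans le_B. Qed.

Lemma exec_within_seq p q s B s1 B' s2 :
  exec_within p s B s1 -> exec_within q s1 B' s2 ->
  exec_within (Seq p q) s (B + B') s2.
Proof.
by case=> n le_n ex [m le_m ex']; exists (n + m); [apply: leq_add|apply: exec_seq ex'].
Qed.

Lemma exec_within_push r x s : exec_within (Push r x) s 2 (upd s r (x :: s r)).
Proof. by exists 2 => //; constructor. Qed.

Lemma exec_within_while_cons r f s x l B s1 B' s2 :
  s r = x :: l -> exec_within (f x) (upd s r l) B s1 ->
  exec_within (While r f) s1 B' s2 ->
  exec_within (While r f) s (B + B').+1 s2.
Proof.
move=> e_l [n le_n ex] [m le_m ex']; exists (n + m).+1; first by rewrite ltnS leq_add.
exact: exec_while_cons ex ex'.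
Qed.

Lemma upd_eq s r v : upd s r v r = v.
Proof. by rewrite /upd eqxx. Qed.

Lemma upd_id s r : upd s r (s r) = s.
Proof. by apply/funext => i; rewrite /upd; case: eqP => // ->. Qed.

Lemma upd_upd s r v v' : upd (upd s r v) r v' = upd s r v'.
Proof. by apply/funext => i; rewrite /upd; case: eqP. Qed.

Lemma upd_neq s r v i : i != r -> upd s r v i = s i.
Proof. by rewrite /upd => /negPf->. Qed.

Definition clear r : cmd X := While r (fun=> Skip).
Definition move_rev r r' : cmd X := While r (Push r').
(** Emptying one stack into another reverses it; the detour through [tmp] restores the order. *)
Definition move r r' tmp : cmd X := Seq (move_rev r tmp) (move_rev tmp r').
Definition copy r r' tmp : cmd X :=
  Seq (move_rev r tmp) (While tmp (fun x => Seq (Push r x) (Push r' x))).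

Lemma exec_clear r s :
  exec_within (clear r) s (2 * size (s r)).+1 (upd s r [::]).
Proof.
move e: (s r) => l; elim: l s e => [|x l IH] s e.
  by exists 1; rewrite // -e upd_id; exact: exec_while_nil.
apply: exec_within_le (exec_within_while_cons (B := 1) e _ _) _.
- by exists 1 => //; constructor.
- by rewrite -(upd_upd s r l [::]); apply: IH; rewrite upd_eq.
- by rewrite /=; lia.
Qed.

Lemma exec_move_rev (r r' : nat) s : r != r' ->
  exec_within (move_rev r r') s (3 * size (s r)).+1
    (upd (upd s r' (catrev (s r) (s r'))) r [::]).
Proof.
move=> ne; move e: (s r) => l; elim: l s e => [|x l IH] s e.
  by exists 1; rewrite // upd_id -e upd_id; exact: exec_while_nil.
apply: exec_within_le (exec_within_while_cons e (exec_within_push _ _ _) _) _.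
- suff -> : upd (upd s r' (catrev (x :: l) (s r'))) r [::] =
    let s1 := upd (upd s r l) r' (x :: upd s r l r') in
    upd (upd s1 r' (catrev l (s1 r'))) r [::].
    by apply: IH; rewrite upd_neq // upd_eq.
  apply/funext => i; rewrite /= /upd eqxx (eq_sym r') (negPf ne).
  by case: (i =P r) => //; case: (i =P r').
- by rewrite /=; lia.
Qed.

Lemma exec_move (r r' tmp : nat) s :
  r != r' -> r != tmp -> r' != tmp -> s tmp = [::] ->
  exec_within (move r r' tmp) s (6 * size (s r)).+2
    (upd (upd s r' (s r ++ s r')) r [::]).
Proof.
move=> ne_rr' ne_rt ne_r't e_t.
apply: exec_within_le (exec_within_seq (exec_move_rev _ ne_rt)
  (B' := (3 * size (s r)).+1) _) _; last by lia.
- set s1 := upd _ r _.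
  have e1 : s1 tmp = rev (s r).
    by rewrite /s1 upd_neq 1?eq_sym // upd_eq e_t -[RHS]cats0 -catrevE.
  have e2 : s1 r' = s r'.
    by rewrite /s1 !upd_neq // eq_sym.
  have := @exec_move_rev tmp r' s1; rewrite eq_sym => /(_ ne_r't).
  rewrite e1 e2 catrevE revK size_rev => h.
  suff -> : upd (upd s r' (s r ++ s r')) r [::] =
     upd (upd s1 r' (s r ++ s r')) tmp [::] by exact: h.
  apply/funext => i; rewrite /s1 /upd.
  case: (i =P tmp) => [->|_]; first by rewrite !(eq_sym tmp) (negPf ne_rt) (negPf ne_r't).
  by case: (i =P r) => [->|//]; rewrite (negPf ne_rr').
Qed.

Lemma exec_copy (r r' tmp : nat) s :
  r != r' -> r != tmp -> r' != tmp -> s tmp = [::] -> s r' = [::] ->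
  exec_within (copy r r' tmp) s (8 * size (s r)).+2 (upd s r' (s r)).
Proof.
move=> ne_rr' ne_rt ne_r't e_t e_r'.
have neqs := (negPf ne_rr', negPf ne_rt, negPf ne_r't, eq_sym r' r, eq_sym tmp r,
  eq_sym tmp r').
apply: exec_within_le (exec_within_seq (exec_move_rev _ ne_rt)
  (B' := (5 * size (s r)).+1) (s2 := upd s r' (s r)) _) _; last by lia.
set s1 := upd _ r _.
have e1 : s1 tmp = rev (s r).
  by rewrite /s1 upd_neq 1?eq_sym // upd_eq e_t -[RHS]cats0 -catrevE.
rewrite -(size_rev (s r)).
have -> : upd s r' (s r) = upd (upd (upd s1 r (catrev (rev (s r)) (s1 r))) r' 
    (catrev (rev (s r)) (s1 r'))) tmp [::].
  apply/funext => i; rewrite /s1 /upd !eqxx !neqs !catrevE revK e_r' !cats0.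
  case: (i =P r') => [->|_]; first by rewrite neqs.
  case: (i =P tmp) => [->|_] //.
  by case: (i =P r) => [->|].
move: (rev _) s1 e1 => l; elim: l => [|x l IH] s1 e.
  by exists 1; rewrite // !upd_id -e upd_id; exact: exec_while_nil.
apply: exec_within_le (exec_within_while_cons (B' := (5 * size l).+1) e
  (exec_within_seq (exec_within_push _ _ _) (exec_within_push _ _ _)) _) _.
- set s2 := upd _ r' _.
  suff -> : upd (upd (upd s1 r (catrev (x :: l) (s1 r))) r' (catrev (x :: l) (s1 r'))) tmp [::] =
    upd (upd (upd s2 r (catrev l (s2 r))) r' (catrev l (s2 r'))) tmp [::].
    by apply: IH; rewrite /s2 /upd !neqs eqxx.
  apply/funext => i; rewrite /s2 /upd !eqxx !neqs.
  by case: (i =P tmp) => // _; case: (i =P r') => // _; case: (i =P r).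
- by rewrite /=; lia.
Qed.
End BoundedExecution.

Ltac read_register := repeat (rewrite upd_eq || (rewrite upd_neq; [|lia])).


(** * Closure properties of polynomial-time computability *)

Section Computable.
Variable X : finType.
Implicit Types (s : store X) (p q : cmd X).

Definition total_size (v : seq (seq X)) := sumn (map size v).

(* [rep e] lists the strings through which a program accesses [e].  The program
   finds them in the registers [args]; it leaves [f e] in register [k], using
   the registers beyond [k] as scratch space. *)
Definition computable E (rep : E -> seq (seq X)) (f : E -> seq X) :=
  forall (args : seq nat) k, all (fun r => r < k) args ->
  exists p P, polynomial P /\
    forall e s, map s args = rep e -> (forall r, k <= r -> s r = [::]) ->
      exec_within p s (P (total_size (rep e))) (upd s k (f e)).

(** Unlike [mask], this keeps everything beyond the end of the bits. The strings of [rep] act as a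
    context of variables, and [[:: false]] drops only the first of them, whatever the length of the
    context. *)
Fixpoint select T (b : bitseq) (l : seq T) : seq T :=
  match b, l with
  | [::], _ => l
  | _, [::] => [::]
  | c :: b', x :: l' => if c then x :: select b' l' else select b' l'
  end.

Lemma map_select T U (h : T -> U) b l : map h (select b l) = select b (map h l).
Proof. by elim: b l => [|[] b IH] [|x l] //=; rewrite ?IH. Qed.

Lemma all_select T (a : pred T) b l : all a l -> all a (select b l).
Proof.
by elim: b l => [|[] b IH] [|x l] //= /andP[a_x /IH]; rewrite ?a_x.
Qed.

Lemma total_size_select b v : total_size (select b v) <= total_size v.
Proof.
elim: b v => [|[] b IH] [|x v] //=; rewrite /total_size /= ?leq_add2l ?IH //.
by rewrite (leq_trans (IH _)) ?leq_addl.
Qed.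

Lemma computable_ext E (rep : E -> seq (seq X)) f g :
  f =1 g -> computable rep f -> computable rep g.
Proof. by move/funext=> ->. Qed.

Lemma computable_select b E' E (h : E' -> E) (rep' : E' -> seq (seq X)) rep f :
  (forall e, rep (h e) = select b (rep' e)) ->
  computable rep f -> computable rep' (fun e => f (h e)).
Proof.
move=> e_rep cf args k lt_args; have [p [P [polyP hp]]] := cf _ _ (all_select b lt_args).
exists p, P; split=> // e s e_args fresh.
apply: exec_within_le (hp (h e) s _ fresh) _; first by rewrite map_select e_args.
by rewrite e_rep; apply/polynomial_mono/total_size_select.
Qed.

Lemma computable_weaken E' E (h : E' -> E) (rep : E -> seq (seq X)) (v : E' -> seq X) f :
  computable rep f ->
  computable (fun e => v e :: rep (h e)) (fun e => f (h e)).
Proof. by apply: (@computable_select [:: false]) => e /=. Qed.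

Lemma computable_reindex E' E (h : E' -> E) (rep : E -> seq (seq X)) f :
  computable rep f -> computable (fun e => rep (h e)) (fun e => f (h e)).
Proof. exact: (@computable_select [::]). Qed.

Lemma map_fresh s (args : seq nat) k v :
  all (fun r => r < k) args -> map (upd s k v) args = map s args.
Proof.
move/allP=> lt_args; apply/eq_in_map => r /lt_args lt_r.
by rewrite upd_neq //; lia.
Qed.

Lemma computable_nil E (rep : E -> seq (seq X)) : computable rep (fun=> [::]).
Proof.
move=> args k _; exists Skip, (fun=> 1); split; first by constructor.
by move=> e s _ fresh; rewrite -(fresh k) // upd_id; exists 1 => //; constructor.
Qed.

Lemma computable_cons E (rep : E -> seq (seq X)) x f :
  computable rep f -> computable rep (fun e => x :: f e).
Proof.
move=> cf args k lt_args; have [p [P [polyP hp]]] := cf _ _ lt_args.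
exists (Seq p (Push k x)), (fun n => P n + 2); split; first by do !constructor.
move=> e s e_args fresh; apply: exec_within_seq (hp e s e_args fresh) _.
by have := exec_within_push k x (upd s k (f e)); rewrite upd_upd upd_eq.
Qed.

Lemma computable_behead E (rep : E -> seq (seq X)) f :
  computable rep f -> computable rep (fun e => behead (f e)).
Proof.
move=> cf args k lt_args; have [p [P [polyP hp]]] := cf _ _ lt_args.
exists (Seq p (Pop k)), (fun n => P n + 1); split; first by do !constructor.
move=> e s e_args fresh; apply: exec_within_seq (hp e s e_args fresh) _.
have := exec_pop k (upd s k (f e)); rewrite upd_upd upd_eq; by exists 1.
Qed.

Lemma computable_var i E (rep : E -> seq (seq X)) :
  computable rep (fun e => nth [::] (rep e) i).
Proof.
move=> args k lt_args; have [lt_i|le_i] := ltnP i (size args); last first.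
  have [p [P [polyP hp]]] := computable_nil rep lt_args.
  exists p, P; split=> // e s e_args fresh; rewrite nth_default; first exact: hp.
  by rewrite -e_args size_map.
have lt_r : nth 0 args i < k by rewrite (all_nthP 0 lt_args).
exists (copy X (nth 0 args i) k k.+1), (fun n => 8 * n + 2).
split; first by do !constructor.
move=> e s e_args fresh.
have -> : nth [::] (rep e) i = s (nth 0 args i) by rewrite -e_args (nth_map 0).
apply: exec_within_le (exec_copy _ _ _ (fresh k.+1 _) (fresh k _)) _; try lia.
rewrite addn2 !ltnS leq_mul2l /= -e_args.
elim: args i lt_i {lt_args lt_r e_args} => //= r args IH [|i] lt_i /=.
  by rewrite /total_size /= leq_addr.
by rewrite /total_size /= (leq_trans (IH i lt_i)) ?leq_addl.
Qed.

Lemma computable_let E (rep : E -> seq (seq X)) g f :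
  computable rep g -> computable (fun e => g e :: rep e) f -> computable rep f.
Proof.
move=> cg cf args k lt_args; have [p [P [polyP hp]]] := cg _ _ lt_args.
have [|q [Q [polyQ hq]]] := cf (k :: args) k.+1.
  by rewrite /= leqnn; apply: sub_all lt_args => r; apply: ltnW.
(* By [exec_size] the intermediate result has at most [P n] symbols, so the second program works on
   a context of total size at most [P n + n]. *)
pose QP n := Q (P n + n).
have polyQP : polynomial QP.
  by apply: (polynomial_comp (Q := fun n => P n + n)) => //; do !constructor.
exists (Seq (Seq p q) (Seq (clear X k) (move X k.+1 k k.+2))),
  (fun n => P n + QP n + (2 * P n + 6 * QP n + 3)).
split; first by do !constructor.
move=> e s e_args fresh.
have p_e := hp e s e_args fresh; set N := total_size (rep e) in p_e *.
have le_g : size (g e) <= P N.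
  case: p_e => n le_n /(exec_size k); rewrite upd_eq fresh // add0n => h.
  exact: leq_trans le_n.
set s1 := upd s k (g e) in p_e.
have q_e : exec_within q s1 (QP N) (upd s1 k.+1 (f e)).
  apply: exec_within_le (hq e s1 _ _) _; first by rewrite /= /s1 map_fresh // e_args upd_eq.
    by move=> r lt_r; rewrite /s1 upd_neq ?fresh //; lia.
  by apply: polynomial_mono => //; rewrite /total_size /= leq_add2r.
have le_f : size (f e) <= QP N.
  case: q_e => n le_n /(exec_size k.+1); rewrite upd_eq /s1 upd_neq ?fresh /=; lia.
set s2 := upd _ k.+1 _ in q_e.
apply: exec_within_seq (exec_within_seq p_e q_e) _.
apply: exec_within_le (exec_within_seq (exec_clear k s2)
  (B' := (6 * size (f e)).+2) _) _.
- set s3 := upd s2 k [::].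
  have -> : upd s k (f e) = upd (upd s3 k (s3 k.+1 ++ s3 k)) k.+1 [::].
    apply/funext => i; rewrite /s3 /s2 /s1 /upd !eqxx.
    have -> : k.+1 == k = false by lia.
    rewrite cats0; case: (i =P k.+1) => [->|_]; last by case: (i =P k).
    by rewrite (_ : k.+1 == k = false) ?fresh //; lia.
  have -> : f e = s3 k.+1 by rewrite /s3 /s2 upd_neq ?upd_eq //; lia.
  apply: exec_move; rewrite ?/s3 ?/s2 ?/s1 ?upd_neq ?fresh //; lia.
- rewrite /s2 /s1 upd_neq; last by lia.
  by rewrite upd_eq; lia.
Qed.

Lemma computable_case E (rep : E -> seq (seq X)) g (f : option X -> E -> seq X) :
  computable rep g -> (forall x, computable rep (f x)) ->
  computable rep (fun e => f (ohead (g e)) e).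
Proof.
move=> cg cf args k lt_args; have [p [P [polyP hp]]] := cg _ _ lt_args.
(* One program for each symbol that may be read; the alphabet is finite, so the sum of their time
   bounds is a polynomial. *)
have /choice[q /choice[Q hq]] x := cf x _ _ lt_args.
exists (Seq p (Case k (fun x => Seq (clear X k) (q x)))).
exists (fun n => P n + (2 * P n + 2 + \sum_(x : option X) Q x n)); split.
  have h : polynomial (fun n => \sum_(x : option X) Q x n).
    by apply: polynomial_sum => x; case: (hq x).
  by do !constructor.
move=> e s e_args fresh; set N := total_size _.
have p_e := hp e s e_args fresh; apply: exec_within_seq (p_e) _.
have le_g : size (g e) <= P N.
  case: p_e => n le_n /(exec_size k); rewrite upd_eq fresh // add0n => h.
  exact: leq_trans le_n.
have [_ /(_ e s e_args fresh)q_e] := hq (ohead (g e)).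
have := exec_within_seq (exec_clear k (upd s k (g e))).
rewrite upd_upd upd_eq -{1}(fresh k) // upd_id => /(_ _ _ _ q_e)[n le_n ex].
exists n.+1; last by apply: exec_case; rewrite upd_eq.
rewrite (bigD1 (ohead (g e))) //=; move: le_n; rewrite -/N; lia.
Qed.

(** Each branch has to be right only on the inputs that reach it, whereas [computable_case] asks for
    branches that are right everywhere. Parsers need this, since they make sense only on codes of
    the proper kind. *)
Lemma computable_sub E (P : E -> bool) (c : X) (rep : E -> seq (seq X)) f :
  computable rep (fun e => nseq (P e) c) ->
  computable (fun e : {e | P e} => rep (sval e)) (fun e => f (sval e)) ->
  computable (fun e : {e | ~~ P e} => rep (sval e)) (fun e => f (sval e)) ->
  computable rep f.
Proof.
move=> cP cf cg args k lt_args; have [p [B [polyB hp]]] := cP _ _ lt_args.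
have [q [Q [polyQ hq]]] := cf _ _ lt_args.
have [r [R [polyR hr]]] := cg _ _ lt_args.
exists (Seq p (Case k (fun x => Seq (clear X k) (if x is Some _ then q else r)))).
exists (fun n => B n + (4 + (Q n + R n))); split; first by do !constructor.
move=> e s e_args fresh; set N := total_size _.
apply: exec_within_seq (hp e s e_args fresh) _.
have := exec_within_seq (exec_clear k (upd s k (nseq (P e) c))).
rewrite upd_upd upd_eq -{1}(fresh k) // upd_id => h.
have [Pe|nPe] := boolP (P e).
  have [n le_n ex] := h _ _ _ (hq (exist _ e Pe) s e_args fresh).
  exists n.+1; first by move: le_n; rewrite /= Pe -/N /=; lia.
  by apply: exec_case; rewrite upd_eq; move: ex; rewrite Pe.
have [n le_n ex] := h _ _ _ (hr (exist _ e nPe) s e_args fresh).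
exists n.+1; first by move: le_n; rewrite /= (negPf nPe) -/N /=; lia.
by apply: exec_case; rewrite upd_eq; move: ex; rewrite (negPf nPe).
Qed.

Section Foldl.
Variables (E T : Type) (rep : E -> seq (seq X)) (ra rb : T -> seq X).
Variables (l : E -> seq X) (i : E -> T) (next : E -> T -> X -> T) (B : nat -> nat).
Let loop_rep (et : E * T) := ra et.2 :: rb et.2 :: rep et.1.

(** A polynomial bound for a single step does not survive iteration. The bound [B] on the
    accumulator after every initial part [u] of the list does: it makes the cost of each turn
    polynomial in the original input, and there are only [size (l e)] turns. The accumulator is an
    abstract value seen through two strings, so that a loop can carry a pair. *)
Lemma computable_foldl2 :
  polynomial B ->
  (forall e u v, l e = u ++ v ->
     size (ra (foldl (next e) (i e) u)) + size (rb (foldl (next e) (i e) u))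
       <= B (total_size (rep e) + size (l e))) ->
  computable rep l ->
  computable rep (fun e => ra (i e)) ->
  computable rep (fun e => rb (i e)) ->
  (forall x, computable loop_rep (fun et => ra (next et.1 et.2 x))) ->
  (forall x, computable loop_rep (fun et => rb (next et.1 et.2 x))) ->
  computable rep (fun e => ra (foldl (next e) (i e) (l e))).
Proof.
move=> polyB le_B cl ca cb cna cnb args k lt_args.
have lt_args_add j : all (fun r => r < j + k) args.
  by apply: sub_all lt_args => r lt_r; rewrite (leq_trans lt_r) ?leq_addl.
have [pl [Pl [polyPl hpl]]] := cl _ _ lt_args.
have [pa [Pa [polyPa hpa]]] := ca _ _ (lt_args_add 1).
have [pb [Pb [polyPb hpb]]] := cb _ _ (lt_args_add 2).
have lt_loop j : all (fun r => r < j.+3 + k) (k.+1 :: k.+2 :: args).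
  by rewrite /= lt_args_add !andbT; lia.
have /choice[qa /choice[Qa hqa]] x := cna x _ _ (lt_loop 0).
have /choice[qb /choice[Qb hqb]] x := cnb x _ _ (lt_loop 1).
(* Register [k] holds the unread part of the list, [k.+1] and [k.+2] the accumulator, [k.+3] and
   [k.+4] its next value. Both new components are computed before the old ones are overwritten, as
   each may depend on both. *)
pose k5 := k.+4.+1.
pose tidy : cmd X := Seq (Seq (clear X k.+1) (clear X k.+2))
  (Seq (move X k.+3 k.+1 k5) (move X k.+4 k.+2 k5)).
pose body x := Seq (Seq (qa x) (qb x)) tidy.
exists (Seq (Seq (Seq pl (Seq pa pb)) (While k body))
            (Seq (clear X k.+2) (move X k.+1 k k.+3))).
(* The list has at most [Pl n] symbols, so [M n] bounds the accumulator at all times; [C n] bounds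
   one turn of the loop, tidying included. *)
pose M n := B (n + Pl n).
pose Q n := \sum_(x : X) Qa x n + \sum_(x : X) Qb x n.
pose C n := Q (M n + n) + (16 * M n + 6).
exists (fun n => Pl n + (Pa n + Pb n) + (Pl n * (C n + 1) + 1) + (8 * M n + 3)).
have polyM : polynomial M.
  by apply: (polynomial_comp (Q := fun n => n + Pl n)) => //; do !constructor.
have polyQ : polynomial Q.
  by constructor; apply: polynomial_sum => x; [case: (hqa x)|case: (hqb x)].
have polyC : polynomial C.
  constructor; last by do !constructor.
  by apply: (polynomial_comp (Q := fun n => M n + n)) => //; do !constructor.
split; first by do ?[assumption | constructor].
move=> e s e_args fresh; set N := total_size (rep e).
pose mk l a b := upd (upd (upd s k l) k.+1 a) k.+2 b.
have mk_args l0 a b : map (mk l0 a b) args = rep e.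
  by rewrite !map_fresh //; [exact: (lt_args_add 1)|exact: (lt_args_add 2)].
have mk_fresh l0 a b r : k.+2 < r -> mk l0 a b r = [::].
  by move=> lt_r; rewrite /mk !upd_neq ?fresh //; lia.
have h_init : exec_within (Seq pl (Seq pa pb)) s (Pl N + (Pa N + Pb N))
    (mk (l e) (ra (i e)) (rb (i e))).
  apply: exec_within_seq (hpl e s e_args fresh) _.
  apply: exec_within_seq (hpa e _ _ _) (hpb e _ _ _).
  - by rewrite map_fresh.
  - by move=> r lt_r; rewrite upd_neq ?fresh //; lia.
  - by rewrite !map_fresh //; exact: (lt_args_add 1).
  - by move=> r lt_r; rewrite !upd_neq ?fresh //; lia.
have le_l : size (l e) <= Pl N.
  have [n le_n] := hpl e s e_args fresh.
  by move/(exec_size k); rewrite upd_eq fresh //= => h; apply: leq_trans le_n.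
have {le_B}le_M u v : l e = u ++ v ->
    size (ra (foldl (next e) (i e) u)) + size (rb (foldl (next e) (i e) u)) <= M N.
  move/le_B/leq_trans; apply; apply: polynomial_mono => //; rewrite leq_add2l //.
have h_tidy l0 a b a' b' : 
  size a + size b <= M N -> size a' + size b' <= M N ->
  exec_within tidy (upd (upd (mk l0 a b) k.+3 a') k.+4 b') (16 * M N + 6)
    (mk l0 a' b').
  move=> le_ab le_ab'; set s0 := upd _ k.+4 _.
  have h1 := exec_clear k.+1 s0.
  set s1 := upd s0 _ _ in h1; have h2 := exec_clear k.+2 s1.
  set s2 := upd s1 _ _ in h2.
  have h3 : exec_within (move X k.+3 k.+1 k5) s2 (6 * size (s2 k.+3)).+2
      (upd (upd s2 k.+1 (s2 k.+3 ++ s2 k.+1)) k.+3 [::]).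
    apply: exec_move; try lia.
    by rewrite /s2 /s1 /s0 !upd_neq ?mk_fresh //; lia.
  set s3 := upd _ k.+3 _ in h3.
  have h4 : exec_within (move X k.+4 k.+2 k5) s3 (6 * size (s3 k.+4)).+2
      (upd (upd s3 k.+2 (s3 k.+4 ++ s3 k.+2)) k.+4 [::]).
    apply: exec_move; try lia.
    by rewrite /s3 /s2 /s1 /s0 !upd_neq ?mk_fresh //; lia.
  set s4 := upd _ k.+4 _ in h4.
  have := exec_within_seq (exec_within_seq h1 h2) (exec_within_seq h3 h4).
  have e0 : s0 k.+1 = a by rewrite /s0 /mk; read_register.
  have e1 : s1 k.+2 = b by rewrite /s1 /s0 /mk; read_register.
  have e2 : s2 k.+3 = a' by rewrite /s2 /s1 /s0 /mk; read_register.
  have e3 : s3 k.+4 = b' by rewrite /s3 /s2 /s1 /s0 /mk; read_register.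
  have -> : s4 = mk l0 a' b'.
    apply/funext => j; rewrite /s4 e3 /s3 e2.
    have [->|n4] := eqVneq j k.+4; first by rewrite mk_fresh; [read_register|lia].
    have [->|n2] := eqVneq j k.+2; first by rewrite /s2 /s1 /s0 /mk; read_register; rewrite cats0.
    have [->|n3] := eqVneq j k.+3; first by rewrite mk_fresh; [read_register|lia].
    have [->|n1] := eqVneq j k.+1; first by rewrite /s2 /s1 /s0 /mk; read_register; rewrite cats0.
    by rewrite /s2 /s1 /s0 /mk !(upd_neq _ _ n1, upd_neq _ _ n2, upd_neq _ _ n3, upd_neq _ _ n4).
  by move/exec_within_le; apply; rewrite e0 e1 e2 e3; lia.
have h_body x u v : l e = u ++ x :: v ->
    let t := foldl (next e) (i e) u in
    exec_within (body x) (mk v (ra t) (rb t)) (C N)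
      (mk v (ra (next e t x)) (rb (next e t x))).
  move=> e_l t.
  have [le_t le_nt] := (le_M _ _ e_l, le_M (rcons u x) v).
  rewrite foldl_rcons cat_rcons -/t in le_nt.
  have le_loop : total_size (loop_rep (e, t)) <= M N + N.
    by rewrite /total_size /= addnA leq_add2r.
  apply: exec_within_seq (h_tidy _ _ _ _ _ le_t (le_nt e_l)).
  rewrite /Q.
  apply: exec_within_le (exec_within_seq
    ((hqa x).2 (e, t) (mk v (ra t) (rb t)) _ _) ((hqb x).2 (e, t) _ _ _)) _.
  - by rewrite /= mk_args /mk; read_register.
  - by move=> r lt_r; rewrite mk_fresh //; lia.
  - by rewrite (map_fresh _ _ (lt_loop 0)) /= mk_args /mk; read_register.
  - by move=> r lt_r; rewrite upd_neq ?mk_fresh //; lia.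
  - apply: leq_add.
      rewrite (bigD1 x) //= (leq_trans _ (leq_addr _ _)) //.
      exact: (polynomial_mono (hqa x).1).
    rewrite [leqRHS](bigD1 x) //= (leq_trans _ (leq_addr _ _)) //.
    exact: (polynomial_mono (hqb x).1).
have h_loop v u : l e = u ++ v ->
    let t := foldl (next e) (i e) u in
    let t' := foldl (next e) t v in
    exec_within (While k body) (mk v (ra t) (rb t)) (size v * (C N + 1) + 1)
      (mk [::] (ra t') (rb t')).
  elim: v u => [|x v IH] u e_l /=.
    by exists 1 => //; apply: exec_while_nil; rewrite /mk; read_register.
  have := IH (rcons u x); rewrite cat_rcons foldl_rcons => /(_ e_l) {}IH.
  apply: exec_within_le (exec_within_while_cons (l := v) _ _ IH) _.
  - by rewrite /mk; read_register.
  - have -> : upd (mk (x :: v) (ra (foldl (next e) (i e) u)) (rb (foldl (next e) (i e) u))) k v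
      = mk v (ra (foldl (next e) (i e) u)) (rb (foldl (next e) (i e) u)).
      apply/funext => j; rewrite /mk; have [->|n0] := eqVneq j k; first by read_register.
      rewrite upd_neq //; have [->|n2] := eqVneq j k.+2; first by read_register.
      rewrite !(upd_neq _ _ n2); have [->|n1] := eqVneq j k.+1; first by read_register.
      by rewrite !upd_neq.
    exact: h_body e_l.
  - lia.
have le_end := le_M (l e) [::]; rewrite cats0 in le_end; have {}le_end := le_end erefl.
have {h_loop} := h_loop (l e) [::] erefl; rewrite /=.
move: le_end; set t := foldl _ _ _ => le_end h_loop.
apply: exec_within_seq (exec_within_seq h_init (exec_within_le h_loop _)) _.
  by rewrite leq_add2r leq_mul2r le_l orbT.
have h1 := exec_clear k.+2 (mk [::] (ra t) (rb t)); set s1 := upd _ _ _ in h1.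
have h2 : exec_within (move X k.+1 k k.+3) s1 (6 * size (s1 k.+1)).+2
    (upd (upd s1 k (s1 k.+1 ++ s1 k)) k.+1 [::]).
  apply: exec_move; try lia.
  by rewrite /s1 !upd_neq ?mk_fresh //; lia.
have e1 : s1 k.+1 = ra t by rewrite /s1 /mk; read_register.
have e2 : mk [::] (ra t) (rb t) k.+2 = rb t by rewrite /mk; read_register.
set s2 := upd _ k.+1 _ in h2; have e3 : s2 = upd s k (ra t).
  apply/funext => j; rewrite /s2 e1 /s1 /mk.
  have [->|n0] := eqVneq j k; first by read_register; rewrite cats0.
  have [->|n1] := eqVneq j k.+1; first by read_register; rewrite fresh.
  have [->|n2] := eqVneq j k.+2; first by read_register; rewrite fresh //; lia.
  by rewrite !upd_neq.
rewrite -e3; apply: exec_within_le (exec_within_seq h1 h2) _.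
by rewrite e1 e2; lia.
Qed.
End Foldl.
End Computable.

(** * Strings and lists of words *)

Section Strings.
Variables (X : finType) (E : Type) (rep : E -> seq (seq X)).
Implicit Types (f g : E -> seq X).

Lemma computable_foldl T (ra : T -> seq X) (l : E -> seq X) (i : E -> T)
    (next : E -> T -> X -> T) (B : nat -> nat) :
  polynomial B ->
  (forall e u v, l e = u ++ v ->
     size (ra (foldl (next e) (i e) u)) <= B (total_size (rep e) + size (l e))) ->
  computable rep l ->
  computable rep (fun e => ra (i e)) ->
  (forall x, computable (fun et : E * T => ra et.2 :: rep et.1)
                        (fun et => ra (next et.1 et.2 x))) ->
  computable rep (fun e => ra (foldl (next e) (i e) (l e))).
Proof.
move=> polyB le_B cl ci cn.
apply: (@computable_foldl2 _ _ _ _ ra (fun=> [::]) _ _ _ B) => //.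
- by move=> e u v e_l; rewrite addn0; apply: le_B e_l.
- exact: computable_nil.
- by move=> x; apply: (@computable_select _ [:: true; false] _ _ id) (cn x).
- by move=> x; apply: computable_nil.
Qed.

Lemma computable_const v : computable rep (fun=> v).
Proof. by elim: v => [|x v IH]; [apply: computable_nil|apply: computable_cons]. Qed.

Lemma computable_rev f : computable rep f -> computable rep (fun e => rev (f e)).
Proof.
move=> cf; have revE (u v : seq X) : foldl (fun a x => x :: a) v u = catrev u v.
  by elim: u v => /=.
pose next (_ : E) (a : seq X) x := x :: a.
apply: (@computable_ext _ _ _ (fun e => foldl (next e) [::] (f e))).
  by move=> e; rewrite revE.
apply: (@computable_foldl _ id f (fun=> [::]) next id) => //.
- by constructor.
- by move=> e u v ->; rewrite revE catrevE cats0 size_rev size_cat; lia.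
- exact: computable_nil.
- by move=> x; apply/computable_cons/(computable_var 0).
Qed.
End Strings.

(** * Truth values and scans of a string *)

Section Booleans.
Variables (X : finType) (tick : X).

Definition bit (b : bool) : seq X := nseq b tick.

Section Terms.
Variables (E : Type) (rep : E -> seq (seq X)).
Implicit Types (f g : E -> seq X) (P Q : E -> bool).

Lemma computable_cat f g :
  computable rep f -> computable rep g -> computable rep (fun e => f e ++ g e).
Proof.
(* With [g e] in the context, its size may enter the bound required of the fold. *)
move=> cf cg; apply: (computable_let cg).
have catE (u v : seq X) : foldl (fun a x => x :: a) v u = rev u ++ v.
  by elim: u v => //= x u IH v; rewrite IH rev_cons cat_rcons.
pose next (_ : E) (a : seq X) x := x :: a.
apply: (@computable_ext _ _ _ (fun e => foldl (next e) (g e) (rev (f e)))).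
  by move=> e; rewrite catE revK.
apply: (@computable_foldl _ _ _ _ id (fun e => rev (f e)) g next id) => //.
- by constructor.
- move=> e u v ->; rewrite catE !size_cat size_rev /total_size /=; lia.
- by apply: computable_rev; apply: (computable_weaken id _).
- exact: (computable_var 0).
- by move=> x; apply/computable_cons/(computable_var 0).
Qed.

Lemma computable_rcons f x :
  computable rep f -> computable rep (fun e => rcons (f e) x).
Proof.
move=> cf; apply: (@computable_ext _ _ _ (fun e => f e ++ [:: x])).
  by move=> e; rewrite cats1.
exact/computable_cat/computable_const.
Qed.

Lemma computable_drop n f :
  computable rep f -> computable rep (fun e => drop n (f e)).
Proof.
move=> cf; elim: n => [|n IH].
  by apply: computable_ext cf => e; rewrite drop0.
apply: computable_ext (computable_behead IH) => e.
by rewrite -drop1 drop_drop.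
Qed.

Lemma computable_if P f g :
  computable rep (fun e => bit (P e)) -> computable rep f -> computable rep g ->
  computable rep (fun e => if P e then f e else g e).
Proof.
move=> cP cf cg; apply: computable_ext (computable_case
  (f := fun x e => if x is Some _ then f e else g e) cP _).
  by move=> e; case: (P e).
by case.
Qed.

Lemma computable_neg P :
  computable rep (fun e => bit (P e)) -> computable rep (fun e => bit (~~ P e)).
Proof.
move=> cP; apply: computable_ext (computable_if cP (computable_nil rep)
  (computable_const rep [:: tick])).
by move=> e; case: (P e).
Qed.

Lemma computable_and P Q :
  computable rep (fun e => bit (P e)) -> computable rep (fun e => bit (Q e)) ->
  computable rep (fun e => bit (P e && Q e)).
Proof.
move=> cP cQ; apply: computable_ext (computable_if cP cQ (computable_nil rep)).
by move=> e; case: (P e).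
Qed.

Lemma computable_or P Q :
  computable rep (fun e => bit (P e)) -> computable rep (fun e => bit (Q e)) ->
  computable rep (fun e => bit (P e || Q e)).
Proof.
move=> /computable_neg cP /computable_neg cQ.
apply: computable_ext (computable_neg (computable_and cP cQ)).
by move=> e; rewrite negb_and !negbK.
Qed.

Lemma computable_all_of (I : Type) (r : seq I) (P : I -> E -> bool) :
  (forall i, computable rep (fun e => bit (P i e))) ->
  computable rep (fun e => bit (all (P^~ e) r)).
Proof.
move=> cP; elim: r => [|i r IH] /=; first exact: computable_const.
exact: computable_and.
Qed.

Lemma computable_ohead (p : pred (option X)) f :
  computable rep f -> computable rep (fun e => bit (p (ohead (f e)))).
Proof.
move=> cf; apply: (computable_case (f := fun x _ => bit (p x)) cf) => x.
exact: computable_const.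
Qed.

End Terms.

Section Scans.
Variables (E : Type) (rep : E -> seq (seq X)).
Implicit Types (f g : E -> seq X).

Lemma computable_all_symbols (p : pred X) f :
  computable rep f -> computable rep (fun e => bit (all p (f e))).
Proof.
move=> cf; pose next (_ : E) b x := b && p x.
have allE b u e : foldl (next e) b u = b && all p u.
  by elim: u b => [|x u IH] b /=; rewrite ?andbT // IH /next andbA.
apply: (@computable_ext _ _ _ (fun e => bit (foldl (next e) true (f e)))).
  by move=> e; rewrite allE.
apply: (@computable_foldl _ _ _ _ bit f (fun=> true) next (fun=> 1)) => //.
- by constructor.
- by move=> e u v _; rewrite size_nseq leq_b1.
- exact: computable_const.
- move=> x; rewrite /next; apply: computable_and; first exact: (computable_var 0).
  exact: computable_const.
Qed.

Lemma computable_prefix f g :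
  computable rep f -> computable rep g ->
  computable rep (fun e => bit (prefix (f e) (g e))).
Proof.
move=> cf cg; apply: (computable_let cg).
pose next (_ : E) (t : option (seq X)) x :=
  if t is Some (y :: v) then if x == y then Some v else None else None.
(* The leading [tick] distinguishes a comparison that has used up all of [g e] from one that has
   failed. *)
pose ra (t : option (seq X)) := if t is Some v then tick :: v else [::].
have noneE e u : foldl (next e) None u = None by elim: u.
have prefixE e u v : bit (prefix u v) =
    (if ohead (ra (foldl (next e) (Some v) u)) is Some _ then [:: tick] else [::]).
  elim: u v => [|x u IH] [|y v] //=; rewrite ?noneE //.
  by case: eqP => _ /=; rewrite ?IH ?noneE.
apply: (@computable_ext _ _ _ (fun e => if ohead (ra (foldl (next e) (Some (g e)) (f e)))
  is Some _ then [:: tick] else [::])) => [e|]; first by rewrite -prefixE.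
apply: (@computable_case _ _ _ _ (fun x _ => if x is Some _ then [:: tick] else [::]));
  last by case=> *; apply: computable_const.
apply: (@computable_foldl _ _ _ _ ra f (fun e => Some (g e)) next (fun n => n + 1)).
- by do !constructor.
- move=> e u v _.
  have : size (ra (foldl (next e) (Some (g e)) u)) <= size (ra (Some (g e))).
    elim: u (Some (g e)) => //= x u IH t; apply: leq_trans (IH _) _.
    by case: t => [[|y w]|] //=; case: eqP => //= _; apply: leqW.
  by move/leq_trans; apply; rewrite /total_size /=; lia.
- exact: (computable_weaken id _).
- by apply: computable_cons; apply: (computable_var 0).
- move=> x; pose t_ (et : E * option (seq X)) := ra et.2.
  apply: (@computable_ext _ _ _ (fun et => if ohead (behead (t_ et)) is Some y then
    if x == y then tick :: behead (behead (t_ et)) else [::] else [::])).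
    by case=> e [[|y v]|] //=; case: eqP.
  have ct : computable (fun et : E * option (seq X) => ra et.2 :: g et.1 :: rep et.1) t_.
    exact: (computable_var 0).
  apply: (@computable_case _ _ _ (fun et => behead (t_ et)) (fun o et => if o is Some y then
    if x == y then tick :: behead (behead (t_ et)) else [::] else [::])).
    exact: computable_behead.
  case=> [y|]; last exact: computable_nil.
  by case: eqP => _; [apply/computable_cons/computable_behead/computable_behead
                     |apply: computable_nil].
Qed.
End Scans.
End Booleans.

(** * Lists of words: folds, quantifiers and counting *)

Section WordLists.
Variables (X : finType) (sep : X) (A : eqType) (letter : A -> X) (unletter : X -> option A).
Hypothesis letterK : pcancel letter unletter.
Hypothesis unletter_sep : unletter sep = None.

Definition enc_word (w : seq A) : seq X := map letter w.
Definition enc_words (ws : seq (seq A)) : seq X :=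
  flatten [seq rcons (enc_word w) sep | w <- ws].
Local Notation bit := (bit sep).

Lemma enc_words_cat ws ws' : enc_words (ws ++ ws') = enc_words ws ++ enc_words ws'.
Proof. by rewrite /enc_words map_cat flatten_cat. Qed.

Lemma size_enc_words ws : size (enc_words ws) = \sum_(w <- ws) (size w).+1.
Proof.
elim: ws => [|w ws IH]; first by rewrite big_nil.
by rewrite big_cons -IH /enc_words /= size_cat size_rcons size_map.
Qed.

Section Terms.
Variables (E : Type) (rep : E -> seq (seq X)).
Implicit Types (ws : E -> seq (seq A)).
Local Notation word_rep := (fun ew : E * seq A => enc_word ew.2 :: rep ew.1).

Lemma computable_prefix_word u v :
  computable rep (fun e => enc_word (u e)) -> computable rep (fun e => enc_word (v e)) ->
  computable rep (fun e => bit (prefix (u e) (v e))).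
Proof.
move=> cu cv; apply: computable_ext (computable_prefix sep cu cv) => e.
have inj := pcan_inj letterK; congr bit.
by elim: (u e) (v e) => [|a s IH] [|b s'] //=; rewrite (inj_eq inj) IH.
Qed.

Lemma computable_foldl_words T (tr : T -> seq X) ws (i : E -> T)
    (next : E -> T -> seq A -> T) (B : nat -> nat) :
  polynomial B ->
  (forall e us vs, ws e = us ++ vs -> size (tr (foldl (next e) (i e) us)) <=
     B (total_size (rep e) + size (enc_words (ws e)))) ->
  computable rep (fun e => enc_words (ws e)) ->
  computable rep (fun e => tr (i e)) ->
  computable (fun et : E * seq A * T => tr et.2 :: enc_word et.1.2 :: rep et.1.1)
             (fun et => tr (next et.1.1 et.2 et.1.2)) ->
  computable rep (fun e => tr (foldl (next e) (i e) (ws e))).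
Proof.
move=> polyB le_B cws ci cn.
(* The code is read symbol by symbol; the second component collects the current word, and the
   separator triggers the step [next]. *)
pose nx e (tw : T * seq A) x :=
  if unletter x is Some a then (tw.1, rcons tw.2 a) else (next e tw.1 tw.2, [::]).
have nx_word e t u w : foldl (nx e) (t, u) (enc_word w) = (t, u ++ w).
  elim: w u => [|a w IH] u /=; first by rewrite cats0.
  by rewrite /nx letterK /= IH cat_rcons.
have nx_words e t l : foldl (nx e) (t, [::]) (enc_words l) = (foldl (next e) t l, [::]).
  elim: l t => //= w l IH t; rewrite /enc_words /= foldl_cat foldl_rcons.
  by rewrite nx_word /nx unletter_sep /= -/(nx e) IH.
(* The part already read may end inside a word. The accumulator is then the fold over the complete
   words, to which [le_B] applies, and the unfinished word is no longer than what has been read. *)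
have nx_prefix e t l u v : enc_words l = u ++ v -> exists us vs w,
    [/\ l = us ++ vs, foldl (nx e) (t, [::]) u = (foldl (next e) t us, w) & size w <= size u].
  elim: l t u => [|w l IH] t u /=.
    by case: u => // _; exists [::], [::], [::].
  rewrite /enc_words /= => e_uv; have [le_u|lt_u] := leqP (size u) (size w).
    exists [::], (w :: l), (take (size u) w); split=> //=; last by rewrite size_take_min geq_minl.
    have e_u : u = enc_word (take (size u) w).
      rewrite /enc_word map_take -[LHS](take_size_cat v erefl) -e_uv.
      by rewrite cat_rcons take_cat size_map ltn_neqAle le_u andbT; case: eqP => //= ->;
         rewrite subnn take0 cats0 -(size_map letter) take_size.
    by rewrite {1}e_u nx_word.
  have e_u : u = rcons (enc_word w) sep ++ drop (size w).+1 u.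
    have := congr1 (take (size w).+1) e_uv.
    by rewrite take_size_cat ?size_rcons ?size_map // takel_cat // => ->; rewrite cat_take_drop.
  move: e_uv; rewrite e_u -catA => /eqP; rewrite eqseq_cat // eqxx /= => /eqP e_uv.
  have [us [vs [w' [-> e_fold le_w']]]] := IH (next e t w) _ e_uv.
  exists (w :: us), vs, w'; split=> //; last by rewrite size_cat (leq_trans le_w') ?leq_addl.
  by rewrite foldl_cat foldl_rcons nx_word /nx unletter_sep /= -/(nx e) e_fold.
apply: (@computable_ext _ _ _ (fun e => tr (foldl (nx e) (i e, [::]) (enc_words (ws e))).1)).
  by move=> e; rewrite nx_words.
apply: (@computable_foldl2 _ _ _ _ (fun tw => tr tw.1) (fun tw => enc_word tw.2) _
  (fun e => (i e, [::])) nx (fun n => B n + n)) => //.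
- by do ?[assumption | constructor].
- move=> e u v e_uv; have [us [vs [w [e_ws -> le_w]]]] := nx_prefix e (i e) _ _ _ e_uv.
  rewrite leq_add ?(le_B e _ _ e_ws) //= size_map (leq_trans le_w) //.
  by rewrite e_uv size_cat; lia.
- exact: computable_nil.
- move=> x; rewrite /nx; case: (unletter x) => [a|]; first exact: (computable_var 0).
  exact: (@computable_select _ [::] _ _ (fun et => (et.1, et.2.2, et.2.1))) cn.
- move=> x; rewrite /nx; case e_x : (unletter x) => [a|]; last exact: computable_nil.
  apply: (@computable_ext _ _ _ (fun et => rcons (enc_word et.2.2) (letter a))).
    by move=> et /=; rewrite /enc_word map_rcons.
  by apply: computable_rcons; apply: (computable_var 1).
Qed.

Lemma computable_all_words ws (P : E -> seq A -> bool) :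
  computable rep (fun e => enc_words (ws e)) ->
  computable word_rep (fun ew => bit (P ew.1 ew.2)) ->
  computable rep (fun e => bit (all (P e) (ws e))).
Proof.
move=> cws cP; pose next e b w := b && P e w.
have allE b u e : foldl (next e) b u = b && all (P e) u.
  by elim: u b => [|x u IH] b /=; rewrite ?andbT // IH /next andbA.
apply: (@computable_ext _ _ _ (fun e => bit (foldl (next e) true (ws e)))).
  by move=> e; rewrite allE.
apply: (@computable_foldl_words _ bit ws (fun=> true) next (fun=> 1)) => //.
- by constructor.
- by move=> e u v _; rewrite size_nseq leq_b1.
- exact: computable_const.
- rewrite /next; apply: computable_and; first exact: (computable_var 0).
  exact: (@computable_select _ [:: false] _ _ fst) cP.
Qed.

Lemma computable_has_words ws (P : E -> seq A -> bool) :
  computable rep (fun e => enc_words (ws e)) ->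
  computable word_rep (fun ew => bit (P ew.1 ew.2)) ->
  computable rep (fun e => bit (has (P e) (ws e))).
Proof.
move=> cws /computable_neg/(computable_all_words (P := fun e w => ~~ P e w) cws).
move=> /computable_neg; apply: computable_ext => e.
by rewrite -(eq_has (a1 := predC (fun w => ~~ P e w))) ?has_predC // => w /=; rewrite negbK.
Qed.

Lemma computable_count_words ws (P : E -> seq A -> bool) :
  computable rep (fun e => enc_words (ws e)) ->
  computable word_rep (fun ew => bit (P ew.1 ew.2)) ->
  computable rep (fun e => bit (count (P e) (ws e) <= 1)).
Proof.
move=> cws cP; pose next e n w := P e w + n.
have countE n u e : foldl (next e) n u = count (P e) u + n.
  by elim: u n => //= w u IH n; rewrite IH /next; lia.
(* Counting is done in unary: the count is at most 1 when nothing is left after one [behead]. *)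
pose cnt e := nseq (foldl (next e) 0 (ws e)) sep.
have c_cnt : computable rep cnt.
  apply: (@computable_foldl_words _ (nseq^~ sep) ws (fun=> 0) next id) => //.
  - by constructor.
  - move=> e u v e_ws; rewrite size_nseq countE addn0 (leq_trans (count_size _ _)) //.
    rewrite (leq_trans _ (leq_addl _ _)) // size_enc_words e_ws big_cat /=.
    by rewrite (leq_trans _ (leq_addr _ _)) // -sum1_size leq_sum.
  - exact: computable_nil.
  apply: (@computable_ext _ _ _ (fun et => bit (P et.1.1 et.1.2) ++ nseq et.2 sep)).
    by move=> et; rewrite -nseqD.
  apply: computable_cat; last exact: (computable_var 0).
  exact: (@computable_select _ [:: false] _ _ fst) cP.
apply: computable_ext (computable_ohead sep (fun x => x == None) (computable_behead c_cnt)) => e.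
by rewrite /cnt countE addn0; case: count => [|[|n]].
Qed.

Lemma computable_flatten_words ws (f : E -> seq A -> seq (seq A)) B :
  polynomial B ->
  (forall e w, w \in ws e -> size (enc_words (f e w)) <= B (total_size (rep e) + size (enc_words (ws e)))) ->
  computable rep (fun e => enc_words (ws e)) ->
  computable word_rep (fun ew => enc_words (f ew.1 ew.2)) ->
  computable rep (fun e => enc_words (flatten (map (f e) (ws e)))).
Proof.
move=> polyB le_B cws cf; pose next e acc w := acc ++ f e w.
have flattenE acc u e : foldl (next e) acc u = acc ++ flatten (map (f e) u).
  by elim: u acc => [|w u IH] acc /=; rewrite ?cats0 // IH /next catA.
apply: (@computable_ext _ _ _ (fun e => enc_words (foldl (next e) [::] (ws e)))).
  by move=> e; rewrite flattenE.
apply: (@computable_foldl_words _ enc_words ws (fun=> [::]) next (fun n => n * B n)) => //.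
- by do ?[assumption | constructor].
- move=> e us vs e_ws; set N := total_size _ + _; rewrite flattenE /=.
  apply: (@leq_trans (size us * B N)).
    have {e_ws}le_us w : w \in us -> size (enc_words (f e w)) <= B N.
      by move=> us_w; apply: le_B; rewrite e_ws mem_cat us_w.
    elim: us le_us => //= w us IH le_us; rewrite enc_words_cat size_cat mulSn.
    by rewrite leq_add ?le_us ?mem_head // IH // => w' us_w'; rewrite le_us // inE us_w' orbT.
  rewrite leq_mul2r; apply/orP; right; rewrite /N size_enc_words e_ws big_cat /=.
  rewrite (leq_trans _ (leq_addl _ _)) // (leq_trans _ (leq_addr _ _)) //.
  by rewrite -sum1_size leq_sum.
- exact: computable_nil.
- apply: (@computable_ext _ _ _ (fun et => enc_words et.2 ++ enc_words (f et.1.1 et.1.2))).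
    by move=> et; rewrite -enc_words_cat.
  apply: computable_cat; first exact: (computable_var 0).
  exact: (@computable_select _ [:: false] _ _ fst) cf.
Qed.

Lemma computable_all_proper_prefixes (w : E -> seq A) (P : E -> seq A -> bool) :
  computable rep (fun e => enc_word (w e)) ->
  computable word_rep (fun ew => bit (P ew.1 ew.2)) ->
  computable rep (fun e => bit (all (fun j => P e (take j (w e))) (iota 0 (size (w e))))).
Proof.
(* At each letter the test concerns the prefix before that letter, so the whole word is never
   tested. *)
move=> cw cP; pose next e (bp : bool * seq A) x :=
  if unletter x is Some a then (bp.1 && P e bp.2, rcons bp.2 a) else bp.
have nextE e v : foldl (next e) (true, [::]) (enc_word v) =
    (all (fun j => P e (take j v)) (iota 0 (size v)), v).
  elim/last_ind: v => // v a IH; rewrite /enc_word map_rcons foldl_rcons IH /next letterK /=.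
  rewrite size_rcons -addn1 iotaD all_cat /= add0n andbT -cats1 take_size_cat //.
  congr (_ && _, _); apply: eq_in_all => j; rewrite mem_iota => /andP[_ lt_j].
  by rewrite take_cat lt_j.
have next_size e u : size (foldl (next e) (true, [::]) u).2 <= size u.
  elim/last_ind: u => // u x; rewrite foldl_rcons size_rcons /next.
  by case: unletter => [a|] /=; rewrite ?size_rcons //; lia.
apply: (@computable_ext _ _ _ (fun e => bit (foldl (next e) (true, [::]) (enc_word (w e))).1)).
  by move=> e; rewrite nextE.
apply: (@computable_foldl2 _ _ _ _ (fun bp => bit bp.1) (fun bp => enc_word bp.2) _
  (fun=> (true, [::])) next (fun n => 1 + n)) => //.
- by do !constructor.
- move=> e u v e_w; rewrite size_nseq size_map leq_add ?leq_b1 //.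
  by rewrite (leq_trans (next_size e u)) // e_w size_cat; lia.
- exact: computable_const.
- exact: computable_nil.
- move=> x; rewrite /next; case: unletter => [a|]; last exact: (computable_var 0).
  apply: computable_and; first exact: (computable_var 0).
  exact: (@computable_select _ [:: false] _ _ (fun et => (et.1, et.2.2))) cP.
- move=> x; rewrite /next; case: unletter => [a|]; last exact: (computable_var 1).
  apply: (@computable_ext _ _ _ (fun et => rcons (enc_word et.2.2) (letter a))).
    by move=> et /=; rewrite /enc_word map_rcons.
  by apply: computable_rcons; apply: (computable_var 1).
Qed.
End Terms.
End WordLists.

(** * Essentially equal extensions and the R-order *)

Section RightIdeals.
Variable A : finType.
Implicit Types (R I J : set (seq A)) (phi psi chi : wpfun A).

Lemma finite_short_words n : finite_set [set u : seq A | size u <= n].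
Proof.
apply: (@sub_finite_set _ _ ((fun p : {m : 'I_n.+1 & m.-tuple A} => tval (tagged p)) @` setT)).
  move=> u /= le_u; exists (Tagged (fun m : 'I_n.+1 => m.-tuple A)
    (in_tuple u : (Ordinal (le_u : size u < n.+1)).-tuple A)) => //.
exact/finite_image/finite_finset.
Qed.

(** Over a finite alphabet there are finitely many words of bounded length. Finite generation of a
    domain or an image thus reduces to exhibiting a length bound, with no generating code to be
    described. *)
Lemma finitely_generatedP R : right_ideal R ->
  (exists2 C, finite_set C & R = right_ideal_gen C) <->
  exists n, forall x, R x -> exists u v, [/\ x = u ++ v, R u & size u <= n].
Proof.
move=> idR; split=> [[C /finite_seqP[s ->] ->]|[n hn]].
  exists (\max_(c <- s) size c) => x [c /= s_c [v _ <-]]; exists c, v; split=> //.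
    by exists c => //; exists [::] => //; rewrite cats0.
  exact: leq_bigmax_seq.
exists (R `&` [set u | size u <= n])%classic.
  by apply: sub_finite_set (finite_short_words n) => u [].
rewrite eqEsubset; split=> [x /hn[u [v [-> Ru le_u]]]|x [u [Ru _] [v _ <-]]].
  by exists u => //; exists v.
exact: idR.
Qed.

(** Principal right ideals [x A^*] suffice as test ideals. *)
Lemma essentialP R' R : right_ideal R ->
  essential R' R <->
  ((R' `<=` R)%classic /\ forall x, R x -> exists w, R' (x ++ w)).
Proof.
move=> idR; split=> -[sub h]; split=> //; [move=> x Rx|move=> I idI [x Ix] IR].
  have [|||z [R'z [w _ e_w]]] := h [set x ++ w | w in setT]%classic.
  - by move=> _ v [w _ <-]; exists (w ++ v); rewrite ?catA.
  - by exists x; exists [::]; rewrite ?cats0.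
  - by move=> _ [w _ <-]; apply: idR.
  by exists w; rewrite e_w.
by have [w R'xw] := h x (IR _ Ix); exists (x ++ w); split=> //; apply: idI.
Qed.

Lemma riHom_ideal phi : riHom phi -> right_ideal (Dom phi).
Proof. by case=> -[]. Qed.

Lemma riHom_cat phi x y w : riHom phi -> phi x = Some y -> phi (x ++ w) = Some (y ++ w).
Proof. by case=> -[_ h] _; apply: h. Qed.

Lemma riHom_bound phi : riHom phi ->
  exists n, forall x, Dom phi x -> exists u v, [/\ x = u ++ v, Dom phi u & size u <= n].
Proof. by case=> -[idD _] /(finitely_generatedP idD). Qed.

Lemma riHom_intro phi n :
  (forall x y w, phi x = Some y -> phi (x ++ w) = Some (y ++ w)) ->
  (forall x, Dom phi x -> exists u v, [/\ x = u ++ v, Dom phi u & size u <= n]) ->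
  riHom phi.
Proof.
move=> hom bnd; have idD : right_ideal (Dom phi).
  by move=> x w [y /(hom _ _ w)]; exists (y ++ w).
by split=> //; apply/finitely_generatedP => //; exists n.
Qed.

Lemma ess_extensionP phi psi : riHom psi ->
  ess_extension psi phi <->
  (restriction phi psi /\ forall x, Dom psi x -> exists w, Dom phi (x ++ w)).
Proof.
move=> hpsi; have idD := riHom_ideal hpsi; split=> -[sub h]; split=> //.
  by case/(essentialP _ idD): h.
by apply/(essentialP _ idD); split=> // x [y /sub]; exists y.
Qed.

Lemma restriction_dom phi psi x : restriction phi psi -> Dom phi x -> Dom psi x.
Proof. by move=> sub [y /sub]; exists y. Qed.

Lemma ess_extension_refl phi : riHom phi -> ess_extension phi phi.
Proof.
move=> hphi; apply/ess_extensionP => //; split=> // x Dx.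
by exists [::]; rewrite cats0.
Qed.

Lemma ess_extension_trans phi psi chi : riHom psi -> riHom chi ->
  ess_extension psi phi -> ess_extension chi psi -> ess_extension chi phi.
Proof.
move=> hpsi hchi /(ess_extensionP _ hpsi)[s1 d1] /(ess_extensionP _ hchi)[s2 d2].
apply/ess_extensionP => //; split=> [x y /s1 /s2 //|x /d2[w /d1[w' D]]].
by exists (w ++ w'); rewrite catA.
Qed.

Lemma ess_extension_upper phi psi chi : riHom psi -> riHom chi ->
  restriction phi psi -> restriction psi chi -> ess_extension chi phi ->
  ess_extension chi psi.
Proof.
move=> hpsi hchi s1 s2 /(ess_extensionP _ hchi)[_ d].
apply/ess_extensionP => //; split=> // x /d[w /(restriction_dom s1)].
by exists w.
Qed.

(** Both extensions agree with [phi] on some word [x ++ w], and the common suffix [w] of the two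
    values cancels. *)
Lemma ess_extension_agree phi psi chi x y z :
  riHom psi -> riHom chi -> ess_extension psi phi -> ess_extension chi phi ->
  psi x = Some y -> chi x = Some z -> y = z.
Proof.
move=> hpsi hchi /(ess_extensionP _ hpsi)[s1 d1] /(ess_extensionP _ hchi)[s2 _] e_y e_z.
have [|w [v e_v]] := d1 x; first by exists y.
have := s1 _ _ e_v; rewrite (riHom_cat w hpsi e_y) => -[e1].
have := s2 _ _ e_v; rewrite (riHom_cat w hchi e_z) => -[e2].
by have := congr1 (take (size v - size w)) (etrans e1 (esym e2));
   rewrite -{1}e1 -e2 !size_cat !addnK !take_size_cat.
Qed.

Definition extension_values phi x : set (seq A) :=
  [set y | exists2 chi, riHom chi /\ ess_extension chi phi & chi x = Some y].

(** This is [max_ext phi], by [max_extE]. All extensions defined at [x] have the same value there,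
    and the default [[::]] is never taken. *)
Definition union_extension phi : wpfun A := fun x =>
  if `[< (extension_values phi x !=set0)%classic >]
  then Some (xget [::] (extension_values phi x)) else None.

Lemma union_extensionP phi x y :
  union_extension phi x = Some y <-> extension_values phi x y.
Proof.
rewrite /union_extension; case: asboolP => [ne|empty]; split=> [|hy] //.
- by case=> <-; case: ne => z; apply: xgetI.
- congr Some; have [chi [h1 h2] e1] := hy.
  have [chi' [h3 h4] e2] := xgetI [::] hy.
  exact: ess_extension_agree h3 h1 h4 h2 e2 e1.
- by case: empty; exists y.
Qed.

Lemma union_extension_restriction phi psi :
  riHom psi -> ess_extension psi phi -> restriction psi (union_extension phi).
Proof. by move=> h1 h2 x y e; apply/union_extensionP; exists psi. Qed.

(* A word of the domain of an essentially equal extension of [phi] that lies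
   outside [Dom phi] is a proper prefix of some generator of [Dom phi], so the
   union of all these extensions still has a finitely generated domain. *)
Lemma riHom_union_extension phi : riHom phi -> riHom (union_extension phi).
Proof.
move=> hphi; have [n hn] := riHom_bound hphi.
apply: (@riHom_intro _ n) => [x y w /union_extensionP[chi h e]|x [y]].
  by apply/union_extensionP; exists chi => //; apply: riHom_cat h.1 e.
move/union_extensionP => [chi [hchi ext] e].
have [s d] := (ess_extensionP _ hchi).1 ext.
have [|w /hn[u [v [e_uv Du le_u]]]] := d x; first by exists y.
have [le_xu|lt_ux] := leqP (size x) (size u).
  exists x, [::]; rewrite cats0; split=> //; last exact: leq_trans le_u.
  by exists y; apply/union_extensionP; exists chi.
exists u, (drop (size u) x); split=> //.
  have := congr1 (take (size u)) e_uv.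
  by rewrite takel_cat ?(ltnW lt_ux) // take_size_cat // => {1}<-; rewrite cat_take_drop.
case: Du => z e_z; exists z; apply/union_extensionP; exists phi => //.
by split=> //; apply: ess_extension_refl.
Qed.

Lemma ess_union_extension phi : riHom phi -> ess_extension (union_extension phi) phi.
Proof.
move=> hphi; apply/ess_extensionP; first exact: riHom_union_extension.
split; first exact/union_extension_restriction/ess_extension_refl.
move=> x [y /union_extensionP[chi [hchi /(ess_extensionP _ hchi)[_ d] e]]].
by apply: d; exists y.
Qed.

Lemma max_extE phi : riHom phi -> max_ext phi = union_extension phi.
Proof.
move=> hphi; have hU := riHom_union_extension hphi; have eU := ess_union_extension hphi.
have maxU : is_max_ess_extension phi (union_extension phi).
  split=> // chi hchi e_chi sub; apply/funext => x.
  case e_x: (union_extension phi x) => [y|]; first exact: sub.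
  case e_c: (chi x) => [y|] //.
  by have := union_extension_restriction hchi e_chi e_c; rewrite e_x.
have [h1 h2 h3] := xgetI phi maxU; symmetry; apply: h3 => //.
exact: union_extension_restriction.
Qed.

Lemma riHom_max_ext phi : riHom phi -> riHom (max_ext phi).
Proof. by move=> h; rewrite max_extE //; apply: riHom_union_extension. Qed.

Lemma ess_max_ext phi : riHom phi -> ess_extension (max_ext phi) phi.
Proof. by move=> h; rewrite max_extE //; apply: ess_union_extension. Qed.

Lemma max_ext_eq phi psi :
  riHom phi -> riHom psi -> ess_extension psi phi -> max_ext psi = max_ext phi.
Proof.
move=> hphi hpsi e; rewrite !max_extE //; apply/funext => x.
have hU := riHom_union_extension hphi.
have sub : restriction (union_extension phi) (union_extension psi).
  apply: union_extension_restriction => //.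
  apply: (ess_extension_upper hpsi hU e.1); last exact: ess_union_extension.
  exact: union_extension_restriction.
have sub' : restriction (union_extension psi) (union_extension phi).
  move=> z y /union_extensionP[chi [hchi e_chi] e_z]; apply/union_extensionP.
  by exists chi => //; split=> //; apply: ess_extension_trans e_chi.
case e_x: (union_extension phi x) => [y|]; first exact: sub.
by case e_x': (union_extension psi x) => [y|] //; rewrite (sub' _ _ e_x') in e_x.
Qed.

(** Some prefix [u] of [x] of length at most [n] lies in the domain. If a short generator of [R]
    that begins [y] is a prefix of [psi u], then [u] itself will do; otherwise [u] is extended by
    the part of the generator beyond [psi u], which adds at most [m] letters. *)
Lemma riHom_preimage_bound psi R : riHom psi -> right_ideal R ->
  (exists n, forall x, R x -> exists u v, [/\ x = u ++ v, R u & size u <= n]) ->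
  exists n, forall x y, psi x = Some y -> R y -> exists u v z,
    [/\ x = u ++ v, psi u = Some z, R z & size u <= n].
Proof.
move=> hpsi idR [m hm]; have [n hn] := riHom_bound hpsi; exists (n + m) => x y e_y Ry.
have [|u [v [e_x [z e_z] le_u]]] := hn x; first by exists y.
have e_zv : y = z ++ v.
  by move: e_y; rewrite e_x (riHom_cat v hpsi e_z) => -[].
have [u' [v' [e_y' Ru' le_u']]] := hm _ Ry.
have [le_u'z|lt_zu'] := leqP (size u') (size z).
  exists u, v, z; split=> //; last by lia.
  suff -> : z = u' ++ drop (size u') z by apply: idR.
  have := congr1 (take (size u')) (etrans (esym e_zv) e_y').
  by rewrite takel_cat // take_size_cat // => {1}<-; rewrite cat_take_drop.
pose w := drop (size z) u'; have e_u' : u' = z ++ w.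
  have := congr1 (take (size z)) (etrans (esym e_zv) e_y').
  by rewrite take_size_cat // takel_cat ?(ltnW lt_zu') // => {1}->; rewrite cat_take_drop.
exists (u ++ w), v', (z ++ w); split.
- move: e_y'; rewrite e_zv e_u' -catA => /eqP; rewrite eqseq_cat // eqxx /= => /eqP e_v.
  by rewrite e_x e_v catA.
- exact: riHom_cat.
- by rewrite -e_u'.
- by rewrite size_cat leq_add // size_drop (leq_trans (leq_subr _ _)).
Qed.

Lemma riHom_comp psi phi : riHom psi -> riHom phi -> riHom (pcomp psi phi).
Proof.
move=> hpsi hphi.
have [n hn] := riHom_preimage_bound hphi (riHom_ideal hpsi) (riHom_bound hpsi).
apply: (@riHom_intro _ n) => [x y w|x [y]]; rewrite /pcomp.
  case e: (phi x) => [z|] //= e'; rewrite (riHom_cat w hphi e) /=.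
  exact: riHom_cat.
case e: (phi x) => [z|] //= e'.
have [|u [v [z' [-> e_u [y' e_y'] le_u]]]] := hn _ _ e; first by exists y.
by exists u, v; split=> //; exists y'; rewrite /= e_u.
Qed.

Definition Im phi : set (seq A) := [set y | exists x, phi x = Some y].

(* For right ideals: every right ideal that meets I meets J. *)
Definition dense_in I J := forall y, I y -> exists w, J (y ++ w).

Lemma dense_in_trans I J K : dense_in I J -> dense_in J K -> dense_in I K.
Proof. by move=> IJ JK y /IJ[w /JK[w' K_y]]; exists (w ++ w'); rewrite catA. Qed.

Lemma right_ideal_Im phi : riHom phi -> right_ideal (Im phi).
Proof. by move=> h y w [x /(riHom_cat w h)]; exists (x ++ w). Qed.

Lemma Im_bound phi : riHom phi ->
  exists n, forall y, Im phi y -> exists u v, [/\ y = u ++ v, Im phi u & size u <= n].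
Proof.
move=> h; apply/finitely_generatedP; first exact: right_ideal_Im.
have [_ [C finC e_D]] := h.
exists [set odflt [::] (phi c) | c in C]%classic; first exact: finite_image.
rewrite eqEsubset; split=> y.
  move=> [x e]; have : Dom phi x by exists y.
  rewrite e_D => -[c Cc [v _ e_x]]; exists (odflt [::] (phi c)); first by exists c.
  exists v => //; have [z e_z] : Dom phi c.
    by rewrite e_D; exists c => //; exists [::]; rewrite ?cats0.
  by move: e; rewrite -e_x e_z (riHom_cat v h e_z) => -[].
move=> [_ [c Cc <-] [v _ <-]]; apply: right_ideal_Im => //.
have [z e_z] : Dom phi c.
  by rewrite e_D; exists c => //; exists [::]; rewrite ?cats0.
by exists c; rewrite e_z.
Qed.

(* For the converse, [alpha] picks a preimage under [phi] of [psi u] only for the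
   shortest prefix [u] of its argument with [psi u] in Im(phi): this makes
   [alpha] a homomorphism. *)
Lemma leR_dense psi phi : thompson_higman psi -> riHom phi ->
  leR psi phi <-> dense_in (Im psi) (Im phi).
Proof.
move=> [psi0 h0 e_psi] hphi; have hpsi : riHom psi by rewrite -e_psi; apply: riHom_max_ext.
split=> [[alpha [a0 ha0 e_a] ->] y [x e_x]|dense].
  have halpha : riHom alpha by rewrite -e_a; apply: riHom_max_ext.
  have hc := riHom_comp hphi halpha.
  have [s d] := (ess_extensionP _ (riHom_max_ext hc)).1 (ess_max_ext hc).
  have [|w [z e_z]] := d x; first by exists y.
  exists w; have := s _ _ e_z; rewrite (riHom_cat w (riHom_max_ext hc) e_x) => -[->].
  by move: e_z; rewrite /pcomp; case: (alpha _) => [v|] //= e; exists v.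
pose D x := `[< exists2 y, psi x = Some y & Im phi y >].
have D_cat x w : D x -> D (x ++ w).
  move=> /asboolP[y e_y Iy]; apply/asboolP; exists (y ++ w); first exact: riHom_cat.
  exact: right_ideal_Im.
(* The range includes [size x], as [x] may have no shorter prefix in [D]. *)
pose cut x := find (fun n => D (take n x)) (iota 0 (size x).+1).
have D_cut x : D x -> D (take (cut x) x) /\ cut x <= size x.
  move=> Dx; have hs : has (fun n => D (take n x)) (iota 0 (size x).+1).
    by apply/hasP; exists (size x); rewrite ?mem_iota ?take_size //=; lia.
  have := nth_find 0 hs; rewrite nth_iota ?add0n -/(cut x); last first.
    by rewrite -(size_iota 0 (size x).+1) -has_find.
  by split=> //; rewrite -ltnS -(size_iota 0 (size x).+1) -has_find.
(* The cut does not move when the argument is extended; therefore [alpha (x ++ w)] is [alpha x]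
   followed by [w]. *)
have cut_cat x w : D x -> cut (x ++ w) = cut x.
  move=> Dx; rewrite /cut size_cat -addSn iotaD find_cat.
  have e_has : {in iota 0 (size x).+1, (fun n => D (take n (x ++ w))) =1 (fun n => D (take n x))}.
    by move=> n; rewrite mem_iota add0n ltnS => /= le_n; rewrite takel_cat.
  have -> : has (fun n => D (take n (x ++ w))) (iota 0 (size x).+1).
    rewrite (eq_in_has e_has); apply/hasP.
    by exists (size x); rewrite ?mem_iota ?take_size //=; lia.
  exact: eq_in_find e_has.
pose preim y := xget [::] [set z | phi z = Some y].
pose alpha x := if D x then
  Some (preim (odflt [::] (psi (take (cut x) x))) ++ drop (cut x) x) else None.
have phi_alpha x : D x -> pcomp phi alpha x = psi x.
  move=> Dx; rewrite /pcomp /alpha Dx /=; have [/asboolP[y e_y Iy] le_c] := D_cut x Dx.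
  rewrite e_y /=; case: Iy => z e_z.
  have e_p : phi (preim y) = Some y.
    by apply: (xgetPex [::] (P := fun z => phi z = Some y)); exists z.
  rewrite (riHom_cat _ hphi e_p).
  by rewrite -(riHom_cat (drop (cut x) x) hpsi e_y) cat_take_drop.
have halpha : riHom alpha.
  have [n hn] := riHom_preimage_bound hpsi (right_ideal_Im hphi) (Im_bound hphi).
  apply: (@riHom_intro _ n) => [x y w|x [y]]; rewrite /alpha.
    case: ifP => // Dx [<-]; have [_ le_c] := D_cut x Dx.
    rewrite D_cat // cut_cat // takel_cat // drop_cat ltn_neqAle le_c andbT -catA.
    case: eqP => //= e_c; rewrite -e_c subnn drop0.
    by rewrite (drop_oversize (n := cut x) (s := x)) // e_c.
  case: ifP => // /asboolP[z e_z Iz] _.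
  have [u [v [z' [-> e_u Iz' le_u]]]] := hn _ _ e_z Iz.
  exists u, v; split=> //; rewrite /Dom /alpha /=.
  by have -> : D u by [apply/asboolP; exists z']; eexists.
have hc := riHom_comp hphi halpha.
have ext : ess_extension psi (pcomp phi alpha).
  apply/ess_extensionP => //; split.
    move=> x y; case Dx: (D x); first by rewrite phi_alpha.
    by rewrite /pcomp /alpha Dx.
  move=> x [y e_y]; have [|w Iyw] := dense y; first by exists x.
  exists w; rewrite /Dom /=; have e_yw := riHom_cat w hpsi e_y.
  by exists (y ++ w); rewrite phi_alpha //; apply/asboolP; exists (y ++ w).
exists (max_ext alpha); first by exists alpha.
(* The factor in the monoid is [max_ext alpha] rather than [alpha]. Both [psi] and the composition
   of [phi] with [max_ext alpha] are essentially equal extensions of the composition of [phi] with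
   [alpha], so their maximal extensions coincide. *)
rewrite /th_mul -{1}e_psi; have hm := riHom_max_ext halpha.
have hcm := riHom_comp hphi hm.
rewrite -(max_ext_eq h0 hpsi); last by rewrite -e_psi; apply: ess_max_ext.
rewrite (max_ext_eq hc hpsi ext) (max_ext_eq hc hcm) //.
have [s d] := (ess_extensionP _ hm).1 (ess_max_ext halpha).
apply/ess_extensionP => //; split=> [x y|x [y]]; rewrite /pcomp.
  by case e: (alpha x) => [z|] //; rewrite (s _ _ e).
case e: (max_ext alpha x) => [z|] //= e'; have [|w [v e_v]] := d x; first by exists z.
exists w; exists (y ++ w); rewrite /= e_v /=.
have := s _ _ e_v; rewrite (riHom_cat w hm e) => -[<-]; exact: riHom_cat.
Qed.
End RightIdeals.

(** * Generators of images *)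

Section Criterion.
Variable A : finType.
Implicit Types (F : seq (seq A)) (T : seq (seq A * seq A)).

Definition prefix_comparable (u v : seq A) := prefix u v || prefix v u.

Lemma prefix_comparable_cat (u v u' v' : seq A) : u ++ v = u' ++ v' -> prefix_comparable u u'.
Proof.
rewrite /prefix_comparable; elim: u u' => [|a u IH] [|b u'] //= [-> /IH].
by rewrite eqxx.
Qed.

Lemma prefix_comparablexx u : prefix_comparable u u.
Proof. by rewrite /prefix_comparable prefix_refl. Qed.

Definition ideal F : set (seq A) := right_ideal_gen [set` F]%classic.

Lemma idealP F x : ideal F x <-> exists2 f, f \in F & prefix f x.
Proof.
split=> [[f Ff [w _ <-]]|[f Ff /prefixP[w ->]]]; first by exists f; rewrite ?prefix_prefix.
by exists f => //; exists w.
Qed.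

(** Comparability of [u] with an element of [F] means that the right ideals [u A^*] and [F A^*]
    intersect. *)
Definition touches F (u : seq A) := has (prefix_comparable u) F.

Definition covers F1 F2 := all (fun y => touches F2 y && all (fun f =>
  all (fun j => prefix y (take j f) ==>
     all (fun a => touches F2 (rcons (take j f) a)) (enum A))
   (iota 0 (size f))) F2) F1.

(* If [y ++ v] is a shortest extension of [y] that is comparable to no element
   of [F2], then either [v] is empty or the longest proper prefix of [y ++ v]
   is a proper prefix of an element of [F2]. *)
Lemma coversP F1 F2 : covers F1 F2 <-> dense_in (ideal F1) (ideal F2).
Proof.
have touchP z w : ideal F2 (z ++ w) -> touches F2 z.
  case/idealP=> f F2f /prefixP[v e_zw]; apply/hasP; exists f => //.
  exact: prefix_comparable_cat e_zw.
split=> [/allP cov x /idealP[y F1y /prefixP[v ->]]|dense]; last first.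
  apply/allP => y F1y; apply/andP; split.
    have [|w /touchP//] := dense y.
    by apply/idealP; exists y; rewrite ?prefix_refl.
  apply/allP => f _; apply/allP => j _; apply/implyP => y_f; apply/allP => a _.
  have [|w /touchP//] := dense (rcons (take j f) a).
  by apply/idealP; exists y; rewrite // -cats1 prefix_catl.
have /andP[touch_y /allP step] := cov y F1y.
have : touches F2 (y ++ v).
  elim/last_ind: v => [|v a IH]; first by rewrite cats0.
  rewrite -rcons_cat; set p := y ++ v in IH *.
  have [f F2f /orP[p_f|f_p]] := hasP IH; last first.
    apply/hasP; exists f => //; rewrite /prefix_comparable -cats1.
    by rewrite (prefix_catl _ f_p) orbT.
  have [lt_pf|le_fp] := ltnP (size p) (size f).
    have /allP/(_ (size p)) := step f F2f.
    rewrite mem_iota add0n lt_pf => /(_ isT).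
    have [w e_f] := prefixP p_f; rewrite {1 2}e_f take_size_cat // /p prefix_prefix /=.
    by move/allP/(_ a); apply; rewrite mem_enum.
  apply/hasP; exists f => //; rewrite /prefix_comparable.
  suff -> : f = p by rewrite -cats1 prefix_prefix orbT.
  have [w e_f] := prefixP p_f; move: le_fp; rewrite e_f size_cat.
  by case: w {e_f} => [|? ?]; rewrite ?cats0 //= ; lia.
case/hasP=> f F2f /orP[/prefixP[w e_f]|f_yv].
  by exists w; apply/idealP; exists f; rewrite -?e_f ?prefix_refl.
by exists [::]; rewrite cats0; apply/idealP; exists f.
Qed.

Fixpoint apply_table T (f : seq A) : seq (seq A) :=
  if T is (c, d) :: T' then
    if prefix c f then [:: d ++ drop (size c) f] else apply_table T' f
  else [::].

Definition image_step T F : seq (seq A) :=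
  flatten (map (apply_table T) F) ++
  [seq cd.2 | cd <- T & has (fun f => prefix f cd.1) F].

Definition tabulates T (phi : wpfun A) :=
  Dom phi = ideal (unzip1 T) /\ forall x y, (x, y) \in T -> phi x = Some y.

Lemma apply_tableP T phi f y : riHom phi -> tabulates T phi ->
  y \in apply_table T f <-> phi f = Some y.
Proof.
move=> hphi [e_D e_T]; have eqT : forall c d, (c, d) \in T -> prefix c f ->
    phi f = Some (d ++ drop (size c) f).
  move=> c d T_cd /prefixP[v ->]; rewrite drop_size_cat //.
  exact/riHom_cat/e_T.
split=> [|e_y].
  elim: T eqT {e_D e_T} => //= -[c d] T IH eqT; case: ifP => [c_f|_].
    by rewrite inE => /eqP ->; apply: eqT; rewrite ?mem_head.
  by apply: IH => c' d' T_cd; apply: eqT; rewrite inE T_cd orbT.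
have /idealP[c0 T_c0 c0_f] : ideal (unzip1 T) f by rewrite -e_D; exists y.
elim: T eqT T_c0 {e_D e_T} => //= -[c d] T IH eqT; rewrite inE; case: ifP => [c_f _|c_f].
  by have := eqT c d; rewrite mem_head e_y => /(_ isT c_f) [->]; rewrite inE.
case/orP=> [/eqP e_c|T_c0]; first by rewrite (_ : c = c0) ?c0_f in c_f.
by apply: IH => // c' d' T_cd; apply: eqT; rewrite inE T_cd orbT.
Qed.

Definition image_of (phi : wpfun A) I : set (seq A) :=
  [set y | exists2 x, I x & phi x = Some y]%classic.

(** A word of the domain that lies in [ideal F] begins with some [f] in [F] and with some argument
    [c] of the table. These are comparable, and the longer one lies both in the domain and in
    [ideal F]; its value is a prefix of the value of the word. *)
Lemma image_of_ideal T phi F : riHom phi -> tabulates T phi ->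
  image_of phi (ideal F) = ideal (image_step T F).
Proof.
move=> hphi tab; have [e_D e_T] := tab; rewrite eqEsubset; split=> y.
  case=> x /idealP[f Ff /prefixP[w e_x]] e_y.
  have [c T_c c_x] : exists2 c, c \in unzip1 T & prefix c x.
    by apply/idealP; rewrite -e_D; exists y.
  have [v e_v] := prefixP c_x; have /mapP[[c' d] T_cd /= e_c] := T_c; subst c'.
  have e_yd : y = d ++ v by move: e_y; rewrite e_v (riHom_cat v hphi (e_T _ _ T_cd)) => -[].
  apply/idealP; have /orP[f_c|c_f] : prefix_comparable f c by apply: prefix_comparable_cat (etrans (esym e_x) e_v).
    exists d; last by rewrite e_yd prefix_prefix.
    rewrite mem_cat; apply/orP; right; apply/mapP; exists (c, d) => //.
    by rewrite mem_filter T_cd andbT; apply/hasP; exists f.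
  have [u e_f] := prefixP c_f; exists (d ++ u).
    rewrite mem_cat; apply/orP; left; apply/flattenP; exists (apply_table T f).
      exact: map_f.
    by apply/(apply_tableP f _ hphi tab); rewrite e_f; apply/riHom_cat/e_T.
  move: e_v; rewrite e_x e_f -catA => /eqP; rewrite eqseq_cat // eqxx /= => /eqP e_v.
  by rewrite e_yd -e_v catA prefix_prefix.
case/idealP=> z; rewrite mem_cat => /orP[/flattenP[_ /mapP[f Ff ->]]|].
  move=> /(apply_tableP f z hphi tab) e_z /prefixP[w ->].
  exists (f ++ w); last exact: riHom_cat.
  by apply/idealP; exists f; rewrite ?prefix_prefix.
case/mapP=> -[c d]; rewrite mem_filter => /andP[/hasP[f Ff f_c] T_cd] -> /prefixP[w ->].
exists (c ++ w); last exact/riHom_cat/e_T.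
by apply/idealP; exists f; rewrite // prefix_catl.
Qed.

Lemma tabulates_exists (phi : wpfun A) : riHom phi -> exists T, tabulates T phi.
Proof.
move=> [_ [C /finite_seqP[s ->] e_D]]; exists [seq (c, odflt [::] (phi c)) | c <- s].
rewrite /tabulates /ideal /unzip1 -map_comp map_id_in //; split=> // x y /mapP[c s_c [-> ->]].
have [z -> //] : Dom phi c.
by rewrite e_D; exists c => //; exists [::]; rewrite ?cats0.
Qed.

(** Each argument is counted as comparable with itself, so the bound 1 excludes repetitions and
    proper prefixes at once. *)
Definition valid_table T :=
  all (fun x => count (prefix_comparable x) (unzip1 T) <= 1) (unzip1 T).

Lemma valid_tableP T :
  valid_table T <-> uniq (unzip1 T) /\ prefix_code [set` unzip1 T]%classic.
Proof.
rewrite /valid_table /prefix_code /=; move: (unzip1 T) => s; split=> [/allP h|[us code]].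
  have h2 u v : u \in s -> v \in s -> prefix_comparable u v -> u = v.
    move=> s_u s_v c_uv; apply/eqP; apply: contraT => ne_uv.
    have := h u s_u.
    have : uniq [:: u; v] by rewrite /= inE ne_uv.
    move/uniq_leq_size => /(_ (filter (prefix_comparable u) s)) /=; rewrite -size_filter.
    have sub : {subset [:: u; v] <= filter (prefix_comparable u) s}.
      by move=> w; rewrite !inE mem_filter => /orP[]/eqP->; rewrite ?prefix_comparablexx ?c_uv.
    by move/(_ sub); case: size => [|[|]].
  split=> [|u v s_u s_v u_v]; last by apply: h2; rewrite // /prefix_comparable u_v.
  apply/negPn/negP => /uniqPn => /(_ [::])[i [j [lt_ij lt_j e_ij]]].
  have := h (nth [::] s j) (mem_nth _ lt_j).
  rewrite -{2}(cat_take_drop j s) count_cat.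
  have h1 : 0 < count (prefix_comparable (nth [::] s j)) (take j s).
    rewrite -has_count; apply/hasP; exists (nth [::] s i); last by rewrite e_ij prefix_comparablexx.
    by rewrite -(nth_take _ lt_ij) mem_nth // size_take lt_j.
  by rewrite (drop_nth [::] lt_j) /= prefix_comparablexx; lia.
apply/allP => u s_u; rewrite (@eq_in_count _ _ (pred1 u)) ?count_uniq_mem ?leq_b1 //.
move=> v s_v /=; apply/idP/eqP => [/orP[]|->]; last exact: prefix_comparablexx.
- by move/(code _ _ s_u s_v).
- by move/(code _ _ s_v s_u).
Qed.

Lemma unzip1_functional T c d d' :
  uniq (unzip1 T) -> (c, d) \in T -> (c, d') \in T -> d = d'.
Proof.
elim: T => //= -[x y] T IH /andP[T_x uT]; rewrite !inE.
case/orP=> [/eqP e|Tcd] /orP[/eqP e'|Tcd']; last exact: IH.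
- by case: e e' => -> -> [].
- by case: e T_x => <- _; rewrite (map_f fst Tcd').
- by case: e' T_x => <- _; rewrite (map_f fst Tcd).
Qed.

(** Any values may be prescribed on a finite prefix code. Hence the combinatorial test [valid_table]
    decides whether a table describes an element. *)
Lemma valid_table_hom T : uniq (unzip1 T) -> prefix_code [set` unzip1 T]%classic ->
  exists phi, riHom phi /\ is_table T phi.
Proof.
move=> uT code; pose phi : wpfun A := fun f => ohead (apply_table T f).
have e_phi c d w : (c, d) \in T -> phi (c ++ w) = Some (d ++ w).
  (* In a prefix code at most one row applies to a word, so taking the first match is harmless. *)
  move=> T_cd; have : forall c' d', (c', d') \in T -> prefix c' (c ++ w) -> c' = c /\ d' = d.
    move=> c' d' T_cd' /prefixP[w' e_w]; have T_c := map_f fst T_cd; have T_c' := map_f fst T_cd'.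
    have e_c : c' = c.
      by have /orP[] := prefix_comparable_cat e_w; [move/(code _ _ T_c T_c')|move/(code _ _ T_c' T_c)].
    by split=> //; subst c'; exact: unzip1_functional uT T_cd' T_cd.
  rewrite /phi; elim: T T_cd {phi uT code} => //= -[x y] T IH.
  rewrite inE => /predU1P[[<- <-] _|T_cd h]; first by rewrite prefix_prefix drop_size_cat.
  case: ifP => [x_c|_]; last first.
    by apply: IH => // c' d' T_cd'; apply: h; rewrite inE T_cd' orbT.
  by have [|-> ->] := h x y _ x_c; rewrite ?mem_head //= drop_size_cat.
have phi_inv f y : phi f = Some y -> exists c d w, [/\ (c, d) \in T, f = c ++ w & y = d ++ w].
  rewrite /phi; elim: T {uT code e_phi phi} => //= -[c d] T IH.
  case: ifP => [/prefixP[w ->]|_ /IH[c' [d' [w [T_cd -> ->]]]]].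
    by rewrite drop_size_cat // => -[<-]; exists c, d, w; rewrite mem_head.
  by exists c', d', w; rewrite inE T_cd orbT.
have e_D : Dom phi = ideal (unzip1 T).
  rewrite eqEsubset; split=> x.
    case=> y /phi_inv[c [d [w [T_cd -> _]]]]; apply/idealP; exists c; last exact: prefix_prefix.
    exact: (map_f fst T_cd).
  case/idealP=> c /mapP[[c' d] T_cd /= ->] /prefixP[w ->].
  by exists (d ++ w); apply: e_phi.
exists phi; split; last first.
  split=> // x y T_xy; rewrite -[x]cats0 -[in RHS](cats0 y); exact: e_phi.
have hom x y w : phi x = Some y -> phi (x ++ w) = Some (y ++ w).
  by case/phi_inv=> c [d [v [T_cd -> ->]]]; rewrite -!catA; apply: e_phi.
split; first split=> //.
  by move=> x w [y /(hom _ _ w)]; exists (y ++ w).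
by exists [set` unzip1 T]%classic => //; apply: finite_finpred.
Qed.
End Criterion.

(** * Programs for generators of images *)

Section Splitting.
Variables (X : finType) (E : Type) (rep : E -> seq (seq X)) (p : pred X).

Lemma computable_take_find (f : E -> seq X) : computable rep f ->
  computable rep (fun e => take (find p (f e)) (f e)).
Proof.
(* The string is read from its end and every hit discards what was collected, so what remains is the
   part before the leftmost hit. *)
move=> cf; pose next (_ : E) (a : seq X) x := if p x then [::] else x :: a.
have nextE e u : foldl (next e) [::] (rev u) = take (find p u) u.
  elim: u => //= x u IH; rewrite rev_cons foldl_rcons IH /next.
  by case: (p x).
apply: (@computable_ext _ _ _ (fun e => foldl (next e) [::] (rev (f e)))).
  by move=> e; rewrite nextE.
apply: (@computable_foldl _ _ _ _ id _ (fun=> [::]) next id) => //.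
- by constructor.
- move=> e u v ->; rewrite size_cat.
  suff : size (foldl (next e) [::] u) <= size u by lia.
  by elim/last_ind: u => // u x; rewrite foldl_rcons size_rcons /next; case: (p x).
- exact: computable_rev.
- exact: computable_nil.
- move=> x; rewrite /next; case: (p x); first exact: computable_nil.
  exact/computable_cons/(computable_var 0).
Qed.

Lemma computable_drop_find (f : E -> seq X) : computable rep f ->
  computable rep (fun e => drop (find p (f e)) (f e)).
Proof.
(* Reading from the end, the second component is the suffix read so far; each hit saves it in the
   first, and the last hit is the leftmost one. *)
move=> cf; pose next (_ : E) (a : seq X * seq X) x :=
  (if p x then x :: a.2 else a.1, x :: a.2).
have nextE e u : foldl (next e) ([::], [::]) (rev u) = (drop (find p u) u, u).
  elim: u => //= x u IH; rewrite rev_cons foldl_rcons IH /next /=.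
  by case: (p x).
apply: (@computable_ext _ _ _ (fun e => (foldl (next e) ([::], [::]) (rev (f e))).1)).
  by move=> e; rewrite nextE.
apply: (@computable_foldl2 _ _ _ _ fst snd _ (fun=> ([::], [::])) next (fun n => n + n)) => //.
- by do !constructor.
- move=> e u v ->; rewrite size_cat.
  suff : size (foldl (next e) ([::], [::]) u).1 <= size u /\
         size (foldl (next e) ([::], [::]) u).2 <= size u by lia.
  elim/last_ind: u => // u x; rewrite foldl_rcons size_rcons /next.
  by case: (p x) => /=; lia.
- exact: computable_rev.
- exact: computable_nil.
- exact: computable_nil.
- move=> x; rewrite /next /=; case: (p x); last exact: (computable_var 0).
  exact/computable_cons/(computable_var 1).
- by move=> x; apply/computable_cons/(computable_var 1).
Qed.
End Splitting.

Section Programs.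
Variables A G : finType.
Local Notation symbol := (symbol A G).
Local Notation X := (symbol + unit)%type.
Local Notation sep := (inr tt : X).
Local Notation bit := (bit sep).
Implicit Types (d : description A G).

Definition letter (a : A) : X := inl (enc_letter G a).
Definition unletter (x : X) : option A :=
  if x is inl (inl (inl a)) then Some a else None.

Lemma letterK : pcancel letter unletter. Proof. by []. Qed.

Local Notation enc_words := (enc_words sep letter).
Local Notation enc_word := (enc_word letter).

Section Terms.
Variables (E : Type) (rep : E -> seq (seq X)).

Lemma computable_comparable (u v : E -> seq A) :
  computable rep (fun e => enc_word (u e)) -> computable rep (fun e => enc_word (v e)) ->
  computable rep (fun e => bit (prefix_comparable (u e) (v e))).
Proof.
by move=> cu cv; apply: computable_or; apply: (computable_prefix_word sep letterK).
Qed.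
(** The table of a generator is fixed, not an input: the induction on [T] unrolls it into nested
    tests of the program. *)
Lemma computable_apply_table T (f : E -> seq A) :
  computable rep (fun e => enc_word (f e)) ->
  computable rep (fun e => enc_words (apply_table T (f e))).
Proof.
move=> cf; elim: T => [|[c d] T IH] /=; first exact: computable_nil.
apply: (@computable_ext _ _ _ (fun e => if prefix c (f e)
    then rcons (enc_word d ++ drop (size c) (enc_word (f e))) sep
    else enc_words (apply_table T (f e)))).
  move=> e; case: ifP => // _; rewrite /enc_words /= cats0 /enc_word.
  by rewrite map_cat map_drop.
apply: computable_if IH.
  by apply: (computable_prefix_word sep letterK) => //; apply: computable_const.
by apply/computable_rcons/computable_cat/computable_drop => //; apply: computable_const.
Qed.

End Terms.

Section WordSets.
Variables (E : Type) (rep : E -> seq (seq X)).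

Lemma computable_touches (F : E -> seq (seq A)) (u : E -> seq A) :
  computable rep (fun e => enc_words (F e)) -> computable rep (fun e => enc_word (u e)) ->
  computable rep (fun e => bit (touches (F e) (u e))).
Proof.
move=> cF cu; apply: (computable_has_words letterK _ cF) => //.
apply: computable_comparable; last exact: (computable_var 0).
exact: (computable_weaken fst _ cu).
Qed.

Lemma computable_valid (xs : E -> seq (seq A)) :
  computable rep (fun e => enc_words (xs e)) ->
  computable rep (fun e => bit (all (fun x => count (prefix_comparable x) (xs e) <= 1) (xs e))).
Proof.
move=> cxs; apply: (computable_all_words letterK _ cxs (P := fun e x => count (prefix_comparable x) (xs e) <= 1)) => //.
apply: (computable_count_words letterK _ (ws := fun ex => xs ex.1) (P := fun ex => prefix_comparable ex.2)) => //.
  exact: (computable_weaken fst _ cxs).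
by apply: computable_comparable; [apply: (computable_var 1)|apply: (computable_var 0)].
Qed.

Definition table_bound (T : seq (seq A * seq A)) := \sum_(cd <- T) (size cd.2).+1.

Lemma size_apply_table T (f : seq A) : size (apply_table T f) <= 1.
Proof. by elim: T => //= -[c d] T IH; case: ifP. Qed.

Lemma size_enc_apply_table T (f : seq A) :
  size (enc_words (apply_table T f)) <= size f + table_bound T.
Proof.
rewrite /table_bound; elim: T => [|[c d] T IH]; first by rewrite big_nil.
rewrite big_cons [apply_table _ _]/=; case: ifP => _; last by apply: leq_trans IH _; lia.
by rewrite size_enc_words big_seq1 size_cat size_drop /=; lia.
Qed.

Lemma computable_image_step T (F : E -> seq (seq A)) :
  computable rep (fun e => enc_words (F e)) ->
  computable rep (fun e => enc_words (image_step T (F e))).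
Proof.
move=> cF; apply: (@computable_ext _ _ _ (fun e => enc_words (flatten (map (apply_table T) (F e)))
  ++ enc_words [seq cd.2 | cd <- T & has (fun f => prefix f cd.1) (F e)])).
  by move=> e; rewrite -enc_words_cat.
apply: computable_cat.
  apply: (computable_flatten_words letterK _ (B := fun n => n + table_bound T)
    (f := fun=> apply_table T) _ _ cF) => //.
  - by do !constructor.
  - move=> e w F_w; rewrite (leq_trans (size_enc_apply_table _ _)) // leq_add2r.
    rewrite (leq_trans _ (leq_addl _ _)) // size_enc_words (perm_big _ (perm_to_rem F_w)) big_cons /=.
    lia.
  - by apply: computable_apply_table; apply: (computable_var 0).
elim: T => [|[c d] T IH] /=; first exact: computable_nil.
apply: (@computable_ext _ _ _ (fun e => if has (fun f => prefix f c) (F e)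
  then enc_words [:: d] ++ enc_words [seq cd.2 | cd <- T & has (fun f => prefix f cd.1) (F e)]
  else enc_words [seq cd.2 | cd <- T & has (fun f => prefix f cd.1) (F e)])).
  by move=> e; case: ifP => //= _; rewrite -enc_words_cat.
apply: computable_if (IH); last by apply: computable_cat => //; apply: computable_const.
apply: (computable_has_words letterK _ cF (P := fun _ f => prefix f c)) => //.
by apply: (computable_prefix_word sep letterK); [apply: (computable_var 0)|apply: computable_const].
Qed.
End WordSets.

Lemma computable_covers E (rep : E -> seq (seq X)) (F1 F2 : E -> seq (seq A)) :
  computable rep (fun e => enc_words (F1 e)) -> computable rep (fun e => enc_words (F2 e)) ->
  computable rep (fun e => bit (covers (F1 e) (F2 e))).
Proof.
move=> cF1 cF2; apply: (computable_all_words letterK _ cF1) => //.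
have cF2' := computable_weaken fst (fun ey => enc_word ey.2) cF2.
apply: computable_and; first by apply: computable_touches cF2' _; apply: (computable_var 0).
apply: (computable_all_words letterK _ cF2') => //.
apply: (@computable_all_proper_prefixes _ sep _ letter unletter letterK _ _ snd (fun eyf p => prefix eyf.1.2 p ==>
     all (fun a => touches (F2 eyf.1.1) (rcons p a)) (enum A))).
  exact: (computable_var 0).
apply: (@computable_ext _ _ _ (fun ep => bit (~~ prefix ep.1.1.2 ep.2 ||
   all (fun a => touches (F2 ep.1.1.1) (rcons ep.2 a)) (enum A)))).
  by move=> ep; rewrite implybE.
apply: computable_or.
  apply/computable_neg/(computable_prefix_word sep letterK).
    exact: (computable_var 2).
  exact: (computable_var 0).
apply: computable_all_of => a; apply: computable_touches.
  exact: (@computable_select _ [:: false; false] _ _ (fun ep => ep.1.1)) cF2'.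
apply: (@computable_ext _ _ _ (fun ep => rcons (enc_word ep.2) (letter a))).
  by move=> ep; rewrite /enc_word map_rcons.
by apply: computable_rcons; apply: (computable_var 0).
Qed.

(** Growth is additive: each word yields at most one new word, longer by a constant at most, and the
    table contributes boundedly many others. Iterated, the number of words grows linearly and their
    total size quadratically. *)
Lemma size_image_step (T : seq (seq A * seq A)) F :
  size (image_step T F) <= size F + table_bound T /\
  size (enc_words (image_step T F)) <=
    size (enc_words F) + table_bound T * size F + table_bound T.
Proof.
rewrite /image_step size_cat enc_words_cat size_cat.
have h1 : size [seq cd.2 | cd <- T & has (fun f => prefix f cd.1) F] <= table_bound T.
  rewrite size_map size_filter (leq_trans (count_size _ _)) // -sum1_size.
  by rewrite /table_bound leq_sum.
have h2 : size (enc_words [seq cd.2 | cd <- T & has (fun f => prefix f cd.1) F]) <= table_bound T.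
  rewrite size_enc_words big_map big_filter /table_bound [leqRHS](bigID (fun cd => has (fun f => prefix f cd.1) F)).
  exact: leq_addr.
have h3 : size (flatten (map (apply_table T) F)) <= size F.
  by elim: F {h1 h2} => //= f F IH; rewrite size_cat; have := size_apply_table T f; lia.
have h4 : size (enc_words (flatten (map (apply_table T) F))) <= size (enc_words F) + table_bound T * size F.
  elim: F {h1 h2 h3} => [//|f F IH]; rewrite enc_words_cat size_cat.
  have -> : size (enc_words (f :: F)) = (size f).+1 + size (enc_words F).
    by rewrite !size_enc_words big_cons.
  have := size_enc_apply_table T f; rewrite [size (f :: F)]/= mulnS => h.
  by apply: leq_trans (leq_add h IH) _; lia.
by split; lia.
Qed.

Section Images.
Variable tab : G -> seq (seq A * seq A).

(** The initial list [[:: [::]]] generates [A^*], the image of the identity. *)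
Definition word_images (w : seq G) := foldr (fun g => image_step (tab g)) [:: [::]] w.

Definition images d := match d with ByTable t => unzip2 t | ByWord w => word_images w end.

Definition generator (g : G) : X := inl (enc_generator A g).

Lemma computable_word_images E (rep : E -> seq (seq X)) (w : E -> seq G) :
  computable rep (fun e => map generator (w e)) ->
  computable rep (fun e => enc_words (word_images (w e))).
Proof.
move=> cw; pose next (_ : E) F (x : X) :=
  if x is inl (inl (inr g)) then image_step (tab g) F else F.
have nextE e u : foldl (next e) [:: [::]] (rev (map generator u)) = word_images u.
  by elim: u => //= g u IH; rewrite rev_cons foldl_rcons IH.
apply: (@computable_ext _ _ _ (fun e => enc_words (foldl (next e) [:: [::]] (rev (map generator (w e)))))).
  by move=> e; rewrite nextE.
(* One constant serves all generators. After [j] letters there are at most [1 + j * K] words, so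
   within a word of length at most [N] a letter adds at most [K * (1 + N * K) + K] to the size of
   the list. *)
pose K := \sum_(g : G) table_bound (tab g).
have le_K g : table_bound (tab g) <= K by rewrite /K (bigD1 g) //= leq_addr.
apply: (@computable_foldl _ _ _ _ enc_words _ (fun=> [:: [::]]) next
  (fun n => 1 + n * (K * (1 + n * K) + K))) => //.
- by do !constructor.
- move=> e u v ->; set N := total_size _ + _.
  have le_u : size u <= N by rewrite /N size_cat; lia.
  suff : size (foldl (next e) [:: [::]] u) <= 1 + size u * K /\
    size (enc_words (foldl (next e) [:: [::]] u)) <= 1 + size u * (K * (1 + N * K) + K).
    case=> _ /leq_trans; apply; rewrite leq_add2l leq_mul2r le_u orbT //.
  clearbody N; elim/last_ind: u le_u => [|u x IH] le_u; first by rewrite size_enc_words big_seq1.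
  rewrite size_rcons in le_u *; have [IH1 IH2] := IH (ltnW le_u).
  rewrite foldl_rcons {1 3}/next; case: x => [[[a|g]|m]|[]]; rewrite ?mulSn; try by split; lia.
  have [h1 h2] := size_image_step (tab g) (foldl (next e) [:: [::]] u).
  have le_g := le_K g; split; first by lia.
  have le_size : size (foldl (next e) [:: [::]] u) <= 1 + N * K.
    by rewrite (leq_trans IH1) // leq_add2l leq_mul2r (ltnW le_u) orbT.
  have := leq_mul le_g le_size; move: h2 IH2 le_g.
  set Y := K * (1 + N * K); set Z := size u * _; lia.
- exact: computable_rev.
- exact: computable_const.
- move=> x; rewrite /next; case: x => [[[a|g]|m]|u]; try exact: (computable_var 0).
  by apply: computable_image_step; apply: (computable_var 0).
Qed.
End Images.
End Programs.

(** * Codes of descriptions *)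

Section Codes.
Variables A G : finType.
Local Notation symbol := (symbol A G).
Local Notation X := (symbol + unit)%type.
Local Notation sep := (inr tt : X).
Local Notation bit := (bit sep).
Local Notation enc_words := (enc_words sep (@letter A G)).
Local Notation letters := (map (@enc_letter A G)).
Local Notation mark m := (enc_mark A G m).
Implicit Types (t : seq (seq A * seq A)) (u : seq symbol) (d : description A G).

Definition is_tag (x : symbol) :=
  if x is inr m then (if m is TableTag then true else if m is WordTag then true else false)
  else false.

Definition is_generator (x : symbol) := if x is inl (inr _) then true else false.

(* Of the code of a table, [in_domain] tells whether the next letter belongs to
   an argument of the function or to a value. *)
Fixpoint scan_table in_domain u :=
  match u with
  | inl (inl _) :: u' => scan_table in_domain u'
  | inr Comma :: u' => in_domain && scan_table false u'
  | inr Semicolon :: u' => ~~ in_domain && scan_table true u'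
  | [::] => true
  | _ => false
  end.

(** [scan_table] tolerates a string that breaks off inside a pair; the test of the last symbol
    excludes this. The default of [last] admits the empty table. *)
Definition is_table_body u :=
  scan_table true u && (last (mark Semicolon) u == mark Semicolon).

Definition is_code u :=
  (ohead u == Some (mark TableTag)) && is_table_body (behead u) ||
  (ohead u == Some (mark WordTag)) && all is_generator (behead u).

(** The search for a tag skips the first symbol, which should be the tag of the first code; the next
    tag opens the second code. *)
Definition head_code (s : seq symbol) := take 1 s ++ take (find is_tag (behead s)) (behead s).
Definition tail_code (s : seq symbol) := drop (find is_tag (behead s)) (behead s).

Lemma head_tail_code s : head_code s ++ tail_code s = s.
Proof. by case: s => // x s; rewrite /head_code /tail_code /= take0 cat_take_drop. Qed.

Lemma scan_letters b (x : seq A) u : scan_table b (letters x ++ u) = scan_table b u.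
Proof. by elim: x. Qed.

Lemma table_body_code t : is_table_body (flatten (map (@enc_pair A G) t)).
Proof.
rewrite /is_table_body; elim: t => //= -[x y] t /andP[IH1 IH2].
rewrite /enc_pair -!catA /= scan_letters /= -cats1 -catA scan_letters /= IH1.
by rewrite !last_cat /= last_cat.
Qed.

(** The default of [last] follows the state: before an argument the string may be over, whereas
    inside a value a semicolon is still due. *)
Lemma scan_table_code b u : scan_table b u ->
  last (mark (if b then Semicolon else Comma)) u == mark Semicolon ->
  if b then exists t, u = flatten (map (@enc_pair A G) t)
  else exists y t, u = letters y ++ mark Semicolon :: flatten (map (@enc_pair A G) t).
Proof.
elim: u b => [|x u IH] b /=; first by case: b => // _ _; exists [::].
case: x => [[a|g]|[]] //= scan; last first.
- by case: b scan => //= scan /(IH true scan)[t ->]; exists [::], t.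
- case: b scan => //= scan /(IH false scan)[y [t ->]].
  by exists (([::], y) :: t); rewrite /= /enc_pair /= cat_rcons.
case: u IH scan => [|x u] IH //= scan last_u.
have := IH b scan; rewrite /= last_u => /(_ isT); case: b {IH scan} => [[t e_t]|[y [t e_t]]].
  case: t e_t => [//|[x' y] t] ->; exists ((a :: x', y) :: t); by [].
by exists (a :: y), t; rewrite e_t.
Qed.

Lemma is_codeP u : is_code u <-> exists d, u = encode d.
Proof.
split=> [|[[t|w] ->]]; last first.
- by rewrite /is_code /= all_map; apply/allP.
- by rewrite /is_code /= table_body_code.
rewrite /is_code; case: u => [//|x u] /= /orP[/andP[/eqP[->]]|/andP[/eqP[->]]].
  by case/andP=> scan /(scan_table_code scan)[t ->]; exists (ByTable G t).
move=> gen_u; have [w ->] : exists w, u = map (@enc_generator A G) w.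
  elim: u gen_u => [|[[a|g]|m] u IH] //=; first by exists [::].
  by case/IH=> w ->; exists (g :: w).
by exists (ByWord A w).
Qed.

Lemma no_tag_encode d : exists x v, [/\ encode d = x :: v, is_tag x & ~~ has is_tag v].
Proof.
case: d => [t|w]; [exists (mark TableTag)|exists (mark WordTag)]; eexists; split=> //.
  apply/hasPn => x /flattenP[_ /mapP[xy _ ->]].
  rewrite mem_cat inE mem_rcons inE orbCA.
  by case/or4P=> [/eqP->|/mapP[a _ ->]|/eqP->|/mapP[a _ ->]].
by rewrite has_map; apply/hasPn.
Qed.

Lemma codes_cat d (e : description A G) :
  head_code (encode d ++ encode e) = encode d /\ tail_code (encode d ++ encode e) = encode e.
Proof.
have [x [v [-> _ v_notag]]] := no_tag_encode d; have [y [w [-> tag_y _]]] := no_tag_encode e.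
rewrite /head_code /tail_code /= take0 find_cat (negPf v_notag) /= tag_y addn0.
by rewrite take_size_cat // drop_size_cat.
Qed.

Lemma letters_cat_inj (x x' : seq A) m u u' :
  letters x ++ mark m :: u = letters x' ++ mark m :: u' -> x = x' /\ u = u'.
Proof.
elim: x x' => [|a x IH] [|a' x'] //= [] //.
by move=> -> /IH[-> ->].
Qed.

Lemma encode_inj : injective (@encode A G).
Proof.
move=> [t|w] [t'|w'] //= [].
  elim: t t' => [|[x y] t IH] [|[x' y'] t'] //=; rewrite /enc_pair /=.
  - by case: x'.
  - by case: x.
  rewrite -!catA /= -!cats1 -!catA => /letters_cat_inj[-> /letters_cat_inj[-> /IH[->]]].
  by [].
by move/(inj_map _) => -> // g g' [].
Qed.

(** * Parsing of codes by folds *)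

Section Parsing.
Variables (E : Type) (rep : E -> seq (seq X)).

(** With [wanted] true the arguments of the table are extracted, otherwise the values; the Boolean
    of the state tells which of them is being read. The output is accumulated in reverse. *)
Definition next_column wanted (state : seq X * bool) (x : X) :=
  match x with
  | inl (inl (inl a)) => (if wanted == state.2 then letter G a :: state.1 else state.1, state.2)
  | inl (inr Comma) => (if wanted then sep :: state.1 else state.1, false)
  | inl (inr Semicolon) => (if wanted then state.1 else sep :: state.1, true)
  | _ => state
  end.

Definition column wanted (u : seq X) : seq X :=
  rev (foldl (next_column wanted) ([::], true) u).1.

Lemma columnE wanted t : column wanted (map inl (flatten (map (@enc_pair A G) t))) =
  enc_words (map (fun xy => if wanted then xy.1 else xy.2) t).
Proof.
have lettersE acc b x : foldl (next_column wanted) (acc, b) (map inl (letters x)) =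
    (if wanted == b then rev (enc_word (@letter A G) x) ++ acc else acc, b).
  elim: x acc => /= [|a x IH] acc; first by case: ifP.
  by rewrite IH /=; case: (wanted == b) => //; rewrite /enc_word /= rev_cons cat_rcons.
suff foldE acc : (foldl (next_column wanted) (acc, true) (map inl (flatten (map (@enc_pair A G) t)))).1 =
    rev (enc_words (map (fun xy => if wanted then xy.1 else xy.2) t)) ++ acc.
  by rewrite /column foldE cats0 revK.
elim: t acc => [//|[x y] t IH] acc /=; rewrite map_cat foldl_cat /enc_pair map_cat /= map_rcons.
rewrite foldl_cat lettersE /= foldl_rcons lettersE /=.
have -> : enc_words ((if wanted then x else y) :: map (fun xy => if wanted then xy.1 else xy.2) t) =
  rcons (enc_word (@letter A G) (if wanted then x else y)) sep ++
  enc_words (map (fun xy => if wanted then xy.1 else xy.2) t) by [].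
by rewrite rev_cat rev_rcons -catA; case: wanted {lettersE} IH => /= IH; rewrite IH.
Qed.

Lemma computable_column wanted (f : E -> seq X) :
  computable rep f -> computable rep (fun e => column wanted (f e)).
Proof.
move=> cf; apply: computable_rev.
apply: (@computable_foldl2 _ _ _ _ fst (fun st => bit st.2) _ (fun=> ([::], true))
  (fun=> next_column wanted) (fun n => n + 1)) => //.
- by do !constructor.
- move=> e u v ->; rewrite size_nseq size_cat leq_add ?leq_b1 //.
  suff h : size (foldl (next_column wanted) ([::], true) u).1 <= size u.
    by apply: leq_trans h _; lia.
  elim/last_ind: u => // u x; rewrite foldl_rcons size_rcons.
  case: (foldl _ _ _) => acc b /=; rewrite /next_column.
  by case: x => [[[a|g]|[]]|] /=; do ?case: ifP => /=; lia.
- exact: computable_nil.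
- exact: computable_const.
- move=> x; have acc := @computable_var _ 0 _ (fun et : E * (seq X * bool) => et.2.1 :: bit et.2.2 :: rep et.1).
  rewrite /next_column; case: x => [[[a|g]|[]]|x] //=; do ?case: wanted => //; try exact: acc;
  try exact: computable_cons acc.
    apply: computable_if; [exact: (computable_var 1)|exact: computable_cons acc|exact: acc].
  apply: (@computable_ext _ _ _ (fun et => if et.2.2 then et.2.1 else letter G a :: et.2.1)).
    by move=> et; case: et.2.2.
  apply: computable_if; [exact: (computable_var 1)|exact: acc|exact: computable_cons acc].
- move=> x; have st := @computable_var _ 1 _ (fun et : E * (seq X * bool) => et.2.1 :: bit et.2.2 :: rep et.1).
  rewrite /next_column; case: x => [[[a|g]|[]]|x] //=; try exact: st; exact: computable_const.
Qed.

Lemma computable_scan (u : E -> seq symbol) :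
  computable rep (fun e => map inl (u e)) ->
  computable rep (fun e => bit (is_table_body (u e))).
Proof.
move=> cu; apply: computable_and; last first.
  apply: computable_ext (computable_ohead sep (fun x => (x == None) ||
    (x == Some (inl (mark Semicolon)))) (computable_rev cu)) => e.
  by case/lastP: (u e) => //= s x; rewrite last_rcons map_rcons rev_rcons.
pose next (st : bool * bool) (x : X) : bool * bool :=
  match x with
  | inl (inl (inl _)) => st
  | inl (inr Comma) => (st.1 && st.2, false)
  | inl (inr Semicolon) => (st.1 && ~~ st.2, true)
  | _ => (false, st.2)
  end.
have nextE ok b s : (foldl next (ok, b) (map inl s)).1 = ok && scan_table b s.
  elim: s ok b => [|[[a|g]|[]] s IH] ok b //=; rewrite ?IH ?andbF ?andbT ?andbA //.
apply: (@computable_ext _ _ _ (fun e => bit (foldl next (true, true) (map inl (u e))).1)).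
  by move=> e; rewrite nextE.
apply: (@computable_foldl2 _ _ _ _ (fun st => bit st.1) (fun st => bit st.2) _ (fun=> (true, true))
  (fun=> next) (fun=> 2)) => //.
- by constructor.
- by move=> e s s' _; rewrite !size_nseq; exact: leq_add (leq_b1 _) (leq_b1 _).
- exact: computable_const.
- exact: computable_const.
- move=> x; pose R (et : E * (bool * bool)) := bit et.2.1 :: bit et.2.2 :: rep et.1.
  have c1 := @computable_var _ 0 _ R; have c2 := @computable_var _ 1 _ R.
  rewrite /next; case: x => [[[a|g]|[]]|x] //=; try exact: c1; try exact: computable_const.
    exact: computable_and c1 c2.
  exact: computable_and c1 (computable_neg c2).
- move=> x; have c2 := @computable_var _ 1 _ (fun et : E * (bool * bool) => bit et.2.1 :: bit et.2.2 :: rep et.1).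
  rewrite /next; case: x => [[[a|g]|[]]|x] //=; try exact: c2; exact: computable_const.
Qed.

Lemma computable_is_code (u : E -> seq symbol) :
  computable rep (fun e => map inl (u e)) ->
  computable rep (fun e => bit (is_code (u e))).
Proof.
move=> cu; have cb : computable rep (fun e => map inl (behead (u e))).
  by apply: computable_ext (computable_behead cu) => e; case: (u e).
have ch m : computable rep (fun e => bit (ohead (u e) == Some (mark m))).
  apply: computable_ext (computable_ohead sep (fun x => x == Some (inl (mark m))) cu) => e.
  by case: (u e).
apply: computable_or; apply: computable_and => //; first exact: computable_scan.
apply: computable_ext (computable_all_symbols sep
  (fun x => if x is inl y then is_generator y else false) cb) => e.
by rewrite all_map.
Qed.

Lemma computable_head_code (u : E -> seq symbol) :
  computable rep (fun e => map inl (u e)) ->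
  computable rep (fun e => map inl (head_code (u e))).
Proof.
move=> cu; have cb : computable rep (fun e => map inl (behead (u e))).
  by apply: computable_ext (computable_behead cu) => e; case: (u e).
pose tag (x : X) := if x is inl y then is_tag y else false.
apply: (@computable_ext _ _ _ (fun e => (if ohead (map inl (u e)) is Some x then [:: x] else [::])
   ++ take (find tag (map inl (behead (u e)))) (map inl (behead (u e))))).
  move=> e; rewrite /head_code find_map -map_take map_cat.
  by case: (u e) => //= x s; rewrite take0.
apply: computable_cat; last exact: computable_take_find.
apply: (computable_case (f := fun x _ => if x is Some x then [:: x] else [::]) cu) => -[x|];
exact: computable_const.
Qed.

Lemma computable_tail_code (u : E -> seq symbol) :
  computable rep (fun e => map inl (u e)) ->
  computable rep (fun e => map inl (tail_code (u e))).
Proof.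
move=> cu; have cb : computable rep (fun e => map inl (behead (u e))).
  by apply: computable_ext (computable_behead cu) => e; case: (u e).
pose tag (x : X) := if x is inl y then is_tag y else false.
apply: (@computable_ext _ _ _ (fun e => drop (find tag (map inl (behead (u e))))
  (map inl (behead (u e))))).
  by move=> e; rewrite /tail_code map_drop find_map.
exact: computable_drop_find.
Qed.
End Parsing.

(** * The decision procedure on codes and its correctness *)

Section Descriptions.
Variable tab : G -> seq (seq A * seq A).

Definition valid d := if d is ByTable t then valid_table t else true.

Definition accepts d (e : description A G) := [&& valid d, valid e & covers (images tab d) (images tab e)].

Section Terms.
Variables (E : Type) (rep : E -> seq (seq X)) (d : E -> description A G).
Hypothesis computable_d : computable rep (fun e => map inl (encode (d e))).

Definition by_table (d : description A G) := if d is ByTable _ then true else false.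
Definition table_of (d : description A G) := if d is ByTable t then t else [::].
Definition word_of (d : description A G) := if d is ByWord w then w else [::].

Lemma computable_by_table : computable rep (fun e => bit (by_table (d e))).
Proof.
apply: computable_ext (computable_ohead sep (fun x => x == Some (inl (mark TableTag))) computable_d).
by move=> e; case: (d e).
Qed.

Lemma computable_images : computable rep (fun e => enc_words (images tab (d e))).
Proof.
have cb (P : E -> bool) : computable (fun e : {e | P e} => rep (sval e))
    (fun e => behead (map inl (encode (d (sval e))))).
  exact: (computable_behead (computable_reindex sval computable_d)).
apply: (computable_sub computable_by_table).
  apply: computable_ext (computable_column false (cb _)) => -[e /=].
  by case: (d e) => //= t _; rewrite columnE.
apply: (@computable_ext _ _ _ (fun e => enc_words (word_images tab (word_of (d (sval e)))))).
  by case=> e /=; case: (d e).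
apply: computable_word_images; apply: computable_ext (cb _) => -[e /=].
by case: (d e) => //= w _; rewrite -map_comp.
Qed.

Lemma computable_valid_description : computable rep (fun e => bit (valid (d e))).
Proof.
apply: (computable_sub computable_by_table); last first.
  apply: computable_ext (computable_const _ (bit true)) => -[e /=].
  by case: (d e).
apply: (@computable_ext _ _ _ (fun e => bit (valid_table (table_of (d (sval e)))))).
  by case=> e /=; case: (d e).
apply: computable_valid; apply: computable_ext (computable_column true (computable_behead
  (computable_reindex sval computable_d))) => -[e /=].
by case: (d e) => //= t _; rewrite columnE.
Qed.
End Terms.

Lemma computable_accepts E (rep : E -> seq (seq X)) (d e : E -> description A G) :
  computable rep (fun x => map inl (encode (d x))) ->
  computable rep (fun x => map inl (encode (e x))) ->
  computable rep (fun x => bit (accepts (d x) (e x))).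
Proof.
move=> cd ce; do 2![apply: computable_and; first exact: computable_valid_description].
by apply: computable_covers; apply: computable_images.
Qed.

Variable gamma : G -> wpfun A.
Hypothesis gamma_th : forall g, thompson_higman (gamma g).
Hypothesis tab_gamma : forall g, tabulates (tab g) (gamma g).

Lemma riHom_thompson_higman (phi : wpfun A) : thompson_higman phi -> riHom phi.
Proof. by case=> psi h <-; apply: riHom_max_ext. Qed.

(** This permits [max_ext] to be dropped at each product: density conditions do not distinguish a
    homomorphism from its essentially equal extensions. *)
Lemma dense_ess_extension (phi psi : wpfun A) : riHom psi -> ess_extension psi phi ->
  dense_in (Im psi) (Im phi) /\ dense_in (Im phi) (Im psi).
Proof.
move=> hpsi /(ess_extensionP _ hpsi)[sub d]; split=> y [x e_x]; last first.
  by exists [::]; rewrite cats0; exists x; apply: sub.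
have [|w [z e_z]] := d x; first by exists y.
exists w, (x ++ w); rewrite e_z; have := sub _ _ e_z.
by rewrite (riHom_cat w hpsi e_x) => -[->].
Qed.

(** Mutual density replaces equality because every product passes to a maximal extension. It
    survives the application of a further generator, since a homomorphism carries an added suffix
    over to its value. *)
Lemma word_value_images w :
  [/\ thompson_higman (word_value gamma w),
      dense_in (Im (word_value gamma w)) (ideal (word_images tab w)) &
      dense_in (ideal (word_images tab w)) (Im (word_value gamma w))].
Proof.
have dense_max (phi : wpfun A) : riHom phi -> dense_in (Im (max_ext phi)) (Im phi) /\
    dense_in (Im phi) (Im (max_ext phi)).
  by move=> h; apply: dense_ess_extension (riHom_max_ext h) (ess_max_ext h).
elim: w => [|g w [th_m m_F F_m]] /=.
  have h1 : riHom (@Some (seq A)).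
    by apply: (@riHom_intro _ _ 0) => [x y w [->] //|x _]; exists [::], x; split=> //; exists [::].
  have [d1 d2] := dense_max _ h1; split; first by exists (@Some (seq A)).
    by move=> y _; exists [::]; apply/idealP; exists [::]; rewrite ?mem_head ?prefix0s.
  by move=> y _; apply: d2; exists y.
have hg := riHom_thompson_higman (gamma_th g); have hm := riHom_thompson_higman th_m.
have hc := riHom_comp hg hm; have [d1 d2] := dense_max _ hc.
split; first by exists (pcomp (gamma g) (word_value gamma w)).
all: rewrite -(image_of_ideal _ hg (tab_gamma g)).
  apply: dense_in_trans d1 _ => y [x]; rewrite /pcomp; case e_z: (word_value _ _ _) => [z|] //= e_y.
  have [|v F_zv] := m_F z; first by exists x.
  by exists v, (z ++ v) => //; apply: riHom_cat.
apply: dense_in_trans d2 => y [x /F_m[v [z e_z]] e_y].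
by exists v, z; rewrite /pcomp e_z /=; apply: riHom_cat.
Qed.

Lemma describes_images d m : describes gamma d m ->
  [/\ valid d, thompson_higman m, dense_in (Im m) (ideal (images tab d)) &
      dense_in (ideal (images tab d)) (Im m)].
Proof.
case: d => [t|w] /=; last by move=> ->; have [] := word_value_images w.
case=> phi [hphi [t_uniq [code e_D] e_t] ->].
have hm := riHom_max_ext hphi; have [d1 d2] := dense_ess_extension hm (ess_max_ext hphi).
have e_I : Im phi = ideal (unzip2 t).
  rewrite eqEsubset; split=> y.
    case=> x e_x; have : Dom phi x by exists y.
    rewrite e_D => -[c t_c [v _ e_cv]]; have /mapP[[c' z] t_cz /= e_c] := t_c; subst c'.
    apply/idealP; exists z; first exact: (map_f snd t_cz).
    by move: e_x; rewrite -e_cv (riHom_cat v hphi (e_t _ _ t_cz)) => -[<-]; apply: prefix_prefix.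
  case/idealP=> z /mapP[[c z'] t_cz /= ->] /prefixP[v ->].
  by exists (c ++ v); apply: riHom_cat (e_t _ _ t_cz).
rewrite -e_I; split=> //; first by apply/valid_tableP.
by exists phi.
Qed.

Lemma valid_describes d : valid d -> exists m, describes gamma d m.
Proof.
case: d => [t|w] /=; last by exists (word_value gamma w).
case/valid_tableP=> /valid_table_hom h /h[phi [hphi tab_phi]].
by exists (max_ext phi), phi.
Qed.

Lemma acceptsP d (e : description A G) : accepts d e <->
  exists psi phi, [/\ describes gamma d psi, describes gamma e phi & leR psi phi].
Proof.
split=> [/and3P[/valid_describes[psi d_psi] /valid_describes[phi e_phi] /coversP cov]|].
  exists psi, phi; split=> //.
  have [_ th_psi psi_d _] := describes_images d_psi.
  have [_ th_phi _ e_phi'] := describes_images e_phi.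
  apply/(leR_dense th_psi (riHom_thompson_higman th_phi)).
  exact: dense_in_trans (dense_in_trans psi_d cov) e_phi'.
case=> psi [phi [/describes_images[vd th_psi _ d_psi] /describes_images[ve th_phi phi_e _]]].
move/(leR_dense th_psi (riHom_thompson_higman th_phi)) => dense.
apply/and3P; split=> //; apply/coversP.
exact: dense_in_trans (dense_in_trans d_psi dense) phi_e.
Qed.

(** Obtained by classical choice and never evaluated by a program: on codes, [encode (decode u)] is
    the string [u] itself, and the programs read only that string. *)
Definition decode u : description A G := 
  if pselect (exists d, encode d = u) is left ex_d then sval (cid ex_d) else ByTable G [::].

Lemma decodeK u : is_code u -> encode (decode u) = u.
Proof.
by case/is_codeP=> d e_d; rewrite /decode; case: pselect => [ex_d|[]]; [case: cid|exists d].
Qed.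

Lemma computable_R_order_problem :
  computable (fun s => [:: map inl s]) (fun s => bit `[< R_order_problem gamma s >]).
Proof.
pose P (s : seq symbol) := is_code (head_code s) && is_code (tail_code s).
have cv : computable (fun s : seq symbol => [:: map inl s : seq X]) (map inl) by apply: (computable_var 0).
have cP : computable (fun s => [:: map inl s]) (fun s => bit (P s)).
  by apply: computable_and; apply: computable_is_code;
     [apply: computable_head_code|apply: computable_tail_code].
apply: (computable_sub cP).
  have cv' := computable_reindex (sval : {s | P s} -> seq symbol) cv.
  apply: (@computable_ext _ _ _ (fun s => bit (accepts (decode (head_code (sval s)))
    (decode (tail_code (sval s)))))) => [[s /= /andP[hd tl]]|].
    congr bit; apply/idP/asboolP => [/acceptsP[psi [phi [d_psi e_phi le_psi]]]|].
      exists (decode (head_code s)), (decode (tail_code s)), psi, phi.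
      by split=> //; rewrite !decodeK // head_tail_code.
    case=> d [e [psi [phi [d_psi e_phi e_s le_psi]]]].
    have [e_d e_e] := codes_cat d e; rewrite -e_s in e_d e_e.
    apply/acceptsP; exists psi, phi; split=> //.
      by rewrite (_ : decode _ = d) //; apply: encode_inj; rewrite decodeK.
    by rewrite (_ : decode _ = e) //; apply: encode_inj; rewrite decodeK.
  apply: computable_accepts.
    apply: computable_ext (computable_head_code cv') => -[s /= /andP[hd _]].
    by rewrite decodeK.
  apply: computable_ext (computable_tail_code cv') => -[s /= /andP[_ tl]].
  by rewrite decodeK.
apply: computable_ext (computable_nil _) => -[s /= nP]; case: asboolP => // R.
case/negP: nP; have [d [e [psi [phi [_ _ e_s _]]]]] := R.
have [e_d e_e] := codes_cat d e; rewrite -e_s in e_d e_e.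
by rewrite /P e_d e_e; apply/andP; split; apply/is_codeP; [exists d|exists e].
Qed.
End Descriptions.
End Codes.

Lemma computable_poly_time (S W : finType) (tick : S + W) (L : set (seq S)) :
  computable (fun s => [:: map inl s]) (fun s => bit tick `[< L s >]) ->
  poly_time_decidable L.
Proof.
move=> cL; have [|p [P [polyP hp]]] := cL [:: 0] 1; first by [].
have [c [d le_P]] := polynomial_le_monomial polyP.
(* Register 0 holds the input and register 1 the answer. The increment in [c.+1] pays for the step
   that reads the verdict. *)
exists (decider p (maxn (max_register p) 1) 1), c.+1, d => s.
have [||n le_n ex] := hp s (initial_store W s); first by [].
  by move=> r; rewrite /initial_store; case: r.
exists `[< L s >]; last by split=> [/asboolP|?]; [|apply/asboolP].
have := decider_correct ex (leq_maxl _ 1) (leq_maxr _ _).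
rewrite upd_eq => /(_ (c.+1 * size s ^ d + c.+1)).
have -> : (bit tick `[< L s >] != [::]) = `[< L s >] by case: `[< L s >].
apply; have := le_P (size s); move: le_n.
by rewrite /total_size /= addn0 size_map mulSn; lia.
Qed.

Theorem theorem5p1 (A : finType) (k_ge2 : 2 <= #|A|)
    (G : finType) (gamma : G -> wpfun A) (gen : generating_set gamma) :
  poly_time_decidable (R_order_problem gamma).
Proof.
have [_ th_gamma _] := gen.
(* The tables of the finitely many generators are built into the machine, so their existence is
   enough. *)
have /choice[tab tab_gamma] g : exists T, tabulates T (gamma g).
  exact/tabulates_exists/riHom_thompson_higman.
exact: computable_poly_time (computable_R_order_problem th_gamma tab_gamma).
Qed.
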